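(* The statement ``for each braid $b$ in $B_3^+$, the $\mathcal{G}_3$-sequence from $b$ is finite'' is (i.e., can be encoded into) an arithmetic statement that is not provable from the axioms of $\mathsf{I\Sigma}_1$.
   Context: $B_3^+$ is the monoid of positive $3$-strand braids, with monoid presentation $\langle\sigma_1,\sigma_2 \mid \sigma_1\sigma_2\sigma_1=\sigma_2\sigma_1\sigma_2\rangle$; $1$ is the trivial braid. Normal words. Put $[k]=1$ for $k$ odd and $[k]=2$ for $k$ even. Every nonempty word $w$ in the letters $\sigma_1,\sigma_2$ can be written $\sigma_{[p]}^{e_p}\cdots\sigma_1^{e_3}\sigma_2^{e_2}\sigma_1^{e_1}$ with $e_k\ge 0$; the unique such expression with $p$ minimal is the block decomposition of $w$, and $\sigma_{[k]}^{e_k}$ is its $k$th block (blocks are numbered from the right; block $1$ may be empty). Put $e^{\min}_1=0$, $e^{\min}_2=1$ and $e^{\min}_k=2$ for $k\ge3$. The word $w$ is called $\phi$-normal if its block decomposition satisfies $e_k\ge e^{\min}_k$ for all $k<p$. Known fact: every nontrivial braid in $B_3^+$ is represented by a unique $\phi$-normal word. The sequence $(e_p,\dots,e_1)$ associated with this word is called the exponent sequence of the braid. Critical position. For $b\ne1$ in $B_3^+$ with exponent sequence $(e_p,\dots,e_1)$, the critical position of $b$ is the least $r<p$ with $e_r>e^{\min}_r$ if such an $r$ exists, and $p$ otherwise. Operation. For $b\neq 1$ in $B_3^+$ and $t\in\mathbb{N}$, let $w$ be the $\phi$-normal word representing $b$ and $r$ the critical position of $b$. Let $w\{t\}$ be the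 word obtained from $w$ by removing one letter from the $r$th block and, if $r\ge2$, adding $t$ letters to the $(r-1)$st block (i.e. $e_r$ is replaced with $e_r-1$ and, if $r\ge 2$, $e_{r-1}$ with $e_{r-1}+t$). Then $b\{t\}$ is the braid represented by $w\{t\}$. $\mathcal{G}_3$-sequence. The $\mathcal{G}_3$-sequence from $b$ is $(b_0,b_1,\dots)$ with $b_0=b$ and $b_t=b_{t-1}\{t\}$ for $t\ge1$; it stops when the trivial braid $1$ is obtained. It is finite if $1$ is obtained after finitely many steps. Arithmetic. First-order arithmetic formulas are written with constants $0,1$, binary operations $+,*$ and a binary relation $<$. $\mathsf{PA}_0$ consists of the axioms $1\ne0$; $\forall x(x+1\ne0)$; $\forall x,y(x+1=y+1\Rightarrow x=y)$; $\forall x(x+0=x)$; $\forall x,y(x+(y+1)=(x+y)+1)$; $\forall x(x*0=0)$; $\forall x,y(x*(y+1)=(x*y)+x)$; $\forall x,y(x<y\Leftrightarrow\exists z\ne0(y=z+x))$. A formula is $\Sigma^0_k$ if it is equivalent to a formula $\exists x_1\forall x_2\exists x_3\cdots Qx_k\,(\Psi)$ in which all quantifiers of $\Psi$ are bounded ($\forall x<y$ or $\exists x<y$). $\mathsf{I\Sigma}_k$ is the theory consisting of $\mathsf{PA}_0$ and, for each $\Sigma^0_k$ formula $\Phi$ with free variables among $x,y_1,\dots,y_p$, the induction axiom $\forall y_1,\dots,y_p\big((\Phi(0)\wedge\forall x(\Phi(x)\Rightarrow\Phi(x+1)))\Rightarrow\forall x\,\Phi(x)\big)$. An arithmetic statement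 is a first-order sentence in this language. A statement about braids is identified with its arithmetic translation obtained by standardly encoding braid words (finite sequences of letters) as natural numbers; the correctness of the encoding can be established using the axioms of $\mathsf{I\Sigma}_1$. *)

(* Defs.v *)
From Stdlib Require List.
From HB Require Import structures.
From mathcomp Require Import all_boot generic_quotient.
From mathcomp Require Import boolp.

Set Implicit Arguments.
Unset Strict Implicit.
Unset Printing Implicit Defensive.

(** [true] is sigma_1 and [false] is sigma_2, so that sigma_[k] is [odd k].
    Words are read from left to right. *)
Definition letter := bool.
Definition sigma (k : nat) : letter := odd k.
Definition word := seq letter.

Inductive braid_cong : word -> word -> Prop :=
| bc_rel : braid_cong [:: sigma 1; sigma 2; sigma 1]
                      [:: sigma 2; sigma 1; sigma 2]
| bc_refl u : braid_cong u u
| bc_sym u v : braid_cong u v -> braid_cong v u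
| bc_trans u v w : braid_cong u v -> braid_cong v w -> braid_cong u w
| bc_cat u u' v v' :
    braid_cong u u' -> braid_cong v v' -> braid_cong (u ++ v) (u' ++ v').

Definition braid_eqb : rel word := fun u v => `[< braid_cong u v >].

Lemma braid_eqb_refl : reflexive braid_eqb.
Proof. by move=> u; apply/asboolP/bc_refl. Qed.

Lemma braid_eqb_sym : symmetric braid_eqb.
Proof. by move=> u v; apply/asboolP/asboolP => /bc_sym. Qed.

Lemma braid_eqb_trans : transitive braid_eqb.
Proof.
by move=> v u w /asboolP uv /asboolP vw; apply/asboolP/(bc_trans uv vw).
Qed.

Canonical braid_equiv_rel :=
  EquivRel braid_eqb braid_eqb_refl braid_eqb_sym braid_eqb_trans.

Definition braid := {eq_quot braid_equiv_rel}%qT.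
HB.instance Definition _ := Choice.on braid.
HB.instance Definition _ := EqQuotient.on braid.

Definition braid_of (w : word) : braid := (\pi_braid w)%qT.

Lemma braid_ofP u v : braid_of u = braid_of v <-> braid_cong u v.
Proof.
split=> [/eqP|/asboolP uv]; last by apply/eqmodP.
by rewrite /braid_of eqmodE => /asboolP.
Qed.

Definition braid_mul (a b : braid) : braid := braid_of (repr a ++ repr b).

Lemma braid_mulE u v : braid_mul (braid_of u) (braid_of v) = braid_of (u ++ v).
Proof.
by apply/braid_ofP; apply: bc_cat; apply/braid_ofP; rewrite /braid_of reprK.
Qed.

Lemma braid_ind (P : braid -> Prop) : (forall w, P (braid_of w)) -> forall b, P b.
Proof. by move=> Pw b; rewrite -[b]reprK; exact: Pw. Qed.

Lemma braid_mulA : associative braid_mul.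
Proof.
elim/braid_ind=> u; elim/braid_ind=> v; elim/braid_ind=> w.
by rewrite !braid_mulE catA.
Qed.

Lemma braid_mul1b : left_id (braid_of [::]) braid_mul.
Proof. by elim/braid_ind=> u; rewrite braid_mulE. Qed.

Lemma braid_mulb1 : right_id (braid_of [::]) braid_mul.
Proof. by elim/braid_ind=> u; rewrite braid_mulE cats0. Qed.

HB.instance Definition _ :=
  isMonoid.Build braid braid_mulA braid_mul1b braid_mulb1.

(** A sequence [e = [:: e_1; ...; e_p]] lists the exponents with the
    rightmost block first; [block e k] is e_k, for 1 <= k <= p = size e. *)
Definition block (e : seq nat) (k : nat) : nat := nth 0 e k.-1.

(** sigma_[p]^e_p ... sigma_1^e_3 sigma_2^e_2 sigma_1^e_1 *)
Definition word_of_blocks (e : seq nat) : word :=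
  flatten [seq nseq (block e k) (sigma k) | k <- rev (iota 1 (size e))].

Definition block_decomposition (w : word) (e : seq nat) : Prop :=
  w = word_of_blocks e /\
  (forall e', w = word_of_blocks e' -> size e <= size e').

Definition emin (k : nat) : nat :=
  match k with 1 => 0 | 2 => 1 | _ => 2 end.

Definition phi_normal (w : word) (e : seq nat) : Prop :=
  [/\ w <> [::], block_decomposition w e
    & forall k, 1 <= k < size e -> emin k <= block e k].

(** [find] returns [(size e).-1] when no r < p satisfies e_r > emin r, in which
    case the result is p. *)
Definition critical (e : seq nat) : nat :=
  (find (fun k => emin k < block e k) (iota 1 (size e).-1)).+1.

(** The exponents of w{t}, where w has exponents [e]; since k ranges over
    positions >= 1, the second case only occurs for a critical position >= 2. *)
Definition reduce_blocks (e : seq nat) (t : nat) : seq nat :=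
  let r := critical e in
  [seq if k == r then (block e k).-1
       else if k.+1 == r then block e k + t else block e k
  | k <- iota 1 (size e)].

(** [braid_step b t b'] states b <> 1 and b' = b{t}. *)
Definition braid_step (b : braid) (t : nat) (b' : braid) : Prop :=
  exists w e, [/\ b = braid_of w, phi_normal w e
                & b' = braid_of (word_of_blocks (reduce_blocks e t))].

Definition G3_stops_at (b : braid) (n : nat) : Prop :=
  exists s : nat -> braid,
    [/\ s 0 = b, forall t, t < n -> s t <> 1%g /\ braid_step (s t) t.+1 (s t.+1)
      & s n = 1%g].

Definition G3_finite (b : braid) : Prop := exists n, G3_stops_at b n.

(** De Bruijn indices: [All] binds [Var 0] of its argument. The other connectives
    are the usual classical abbreviations. *)
Inductive term : Type :=
| Var of nat | Zero | One | Add of term & term | Mul of term & term.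

Inductive form : Type :=
| Eq of term & term | Lt of term & term | Bot | Imp of form & form | All of form.

Definition Not A := Imp A Bot.
Definition And A B := Not (Imp A (Not B)).
Definition Or A B := Imp (Not A) B.
Definition Iff A B := And (Imp A B) (Imp B A).
Definition Ex A := Not (All (Not A)).

Fixpoint tsubst (s : nat -> term) (t : term) : term :=
  match t with
  | Var i => s i
  | Zero => Zero
  | One => One
  | Add a b => Add (tsubst s a) (tsubst s b)
  | Mul a b => Mul (tsubst s a) (tsubst s b)
  end.

Definition tshift (t : term) : term := tsubst (fun i => Var i.+1) t.

Definition scons {T : Type} (x : T) (s : nat -> T) : nat -> T :=
  fun i => if i is j.+1 then s j else x.

Definition up (s : nat -> term) : nat -> term :=
  scons (Var 0) (fun i => tshift (s i)).

Fixpoint subst (s : nat -> term) (A : form) : form :=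
  match A with
  | Eq a b => Eq (tsubst s a) (tsubst s b)
  | Lt a b => Lt (tsubst s a) (tsubst s b)
  | Bot => Bot
  | Imp A B => Imp (subst s A) (subst s B)
  | All A => All (subst (up s) A)
  end.

Definition shift (A : form) : form := subst (fun i => Var i.+1) A.

(** Instantiate variable 0 by [t], lowering the other variables. *)
Definition inst (t : term) (A : form) : form := subst (scons t Var) A.

(** [tbelow n t], [below n A]: all free variables are among [Var 0 .. Var n.-1]. *)
Fixpoint tbelow (n : nat) (t : term) : bool :=
  match t with
  | Var i => i < n
  | Zero | One => true
  | Add a b | Mul a b => tbelow n a && tbelow n b
  end.

Fixpoint below (n : nat) (A : form) : bool :=
  match A with
  | Eq a b | Lt a b => tbelow n a && tbelow n b
  | Bot => true
  | Imp A B => below n A && below n B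
  | All A => below n.+1 A
  end.

Definition sentence (A : form) : bool := below 0 A.

(** Classical natural deduction with equality; axioms in [T] are meant to be
    sentences, so they need no shifting under [All]. *)
Inductive deriv (T : form -> Prop) : seq form -> form -> Prop :=
| d_ax G A : T A -> deriv T G A
| d_hyp G A : List.In A G -> deriv T G A
| d_impI G A B : deriv T (A :: G) B -> deriv T G (Imp A B)
| d_impE G A B : deriv T G (Imp A B) -> deriv T G A -> deriv T G B
| d_raa G A : deriv T (Not A :: G) Bot -> deriv T G A
| d_allI G A : deriv T (map shift G) A -> deriv T G (All A)
| d_allE G A t : deriv T G (All A) -> deriv T G (inst t A)
| d_refl G t : deriv T G (Eq t t)
| d_subst G A t u :
    deriv T G (Eq t u) -> deriv T G (inst t A) -> deriv T G (inst u A).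

Definition provable (T : form -> Prop) (A : form) : Prop := deriv T [::] A.

Definition logically_equivalent (A B : form) : Prop :=
  provable (fun=> False) (Iff A B).

Fixpoint teval (rho : nat -> nat) (t : term) : nat :=
  match t with
  | Var i => rho i
  | Zero => 0
  | One => 1
  | Add a b => teval rho a + teval rho b
  | Mul a b => teval rho a * teval rho b
  end.

Fixpoint holds (rho : nat -> nat) (A : form) : Prop :=
  match A with
  | Eq a b => teval rho a = teval rho b
  | Lt a b => teval rho a < teval rho b
  | Bot => False
  | Imp A B => holds rho A -> holds rho B
  | All A => forall x, holds (scons x rho) A
  end.

Definition true_in_N (A : form) : Prop := forall rho, holds rho A.

(** A [tm] or [fm] maps the number [d] of enclosing quantifiers to the de Bruijn
    term or formula to be used at that depth. Thus a variable bound at depth [l]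
    is [Var (d - l.+1)] when used at depth [d], and quantified formulas can be
    written with Rocq binders. *)
Definition tm := nat -> term.
Definition fm := nat -> form.

Definition tzero : tm := fun=> Zero.
Definition tone : tm := fun=> One.
Definition tadd (a b : tm) : tm := fun d => Add (a d) (b d).
Definition tmul (a b : tm) : tm := fun d => Mul (a d) (b d).
Definition feq (a b : tm) : fm := fun d => Eq (a d) (b d).
Definition flt (a b : tm) : fm := fun d => Lt (a d) (b d).
Definition fnot (A : fm) : fm := fun d => Not (A d).
Definition fimp (A B : fm) : fm := fun d => Imp (A d) (B d).
Definition fand (A B : fm) : fm := fun d => And (A d) (B d).
Definition for_ (A B : fm) : fm := fun d => Or (A d) (B d).
Definition fiff (A B : fm) : fm := fun d => Iff (A d) (B d).
Definition bvar (l : nat) : tm := fun d => Var (d - l.+1).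
Definition fall (F : tm -> fm) : fm := fun d => All (F (bvar d) d.+1).
Definition fex (F : tm -> fm) : fm := fun d => Ex (F (bvar d) d.+1).

(** The [i]th free variable of the whole formula. *)
Definition fvar (i : nat) : tm := fun d => Var (d + i).

Definition formula (A : fm) : form := A 0.

Declare Scope fm_scope.
Delimit Scope fm_scope with fm.
Bind Scope fm_scope with tm.
Bind Scope fm_scope with fm.
Notation "0" := tzero : fm_scope.
Notation "1" := tone : fm_scope.
Notation "2" := (tadd tone tone) : fm_scope.
Notation "a + b" := (tadd a b) : fm_scope.
Notation "a * b" := (tmul a b) : fm_scope.
Notation "a == b" := (feq a b) : fm_scope.
Notation "a != b" := (fnot (feq a b)) : fm_scope.
Notation "a < b" := (flt a b) : fm_scope.
Notation "a <= b" := (flt a (tadd b tone)) : fm_scope.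
Notation "~~ A" := (fnot A) : fm_scope.
Notation "A && B" := (fand A B) : fm_scope.
Notation "A || B" := (for_ A B) : fm_scope.
Notation "A ==> B" := (fimp A B) : fm_scope.
Notation "A <==> B" := (fiff A B) (at level 95, no associativity) : fm_scope.
Notation "'ALL' x , A" := (fall (fun x : tm => A%fm))
  (at level 200, x name, A at level 200, right associativity) : fm_scope.
Notation "'EX' x , A" := (fex (fun x : tm => A%fm))
  (at level 200, x name, A at level 200, right associativity) : fm_scope.
Notation "'ALL' x < t , A" := (fall (fun x : tm => fimp (flt x t) A%fm))
  (at level 200, x name, t at level 69, A at level 200) : fm_scope.
Notation "'EX' x < t , A" := (fex (fun x : tm => fand (flt x t) A%fm))
  (at level 200, x name, t at level 69, A at level 200) : fm_scope.

Inductive PA0 : form -> Prop :=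
| PA0_one : PA0 (formula (1 != 0))
| PA0_succ0 : PA0 (formula (ALL x, x + 1 != 0))
| PA0_succI : PA0 (formula (ALL x, ALL y, (x + 1 == y + 1) ==> (x == y)))
| PA0_add0 : PA0 (formula (ALL x, x + 0 == x))
| PA0_addS : PA0 (formula (ALL x, ALL y, x + (y + 1) == (x + y) + 1))
| PA0_mul0 : PA0 (formula (ALL x, x * 0 == 0))
| PA0_mulS : PA0 (formula (ALL x, ALL y, x * (y + 1) == (x * y) + x))
| PA0_lt : PA0 (formula (ALL x, ALL y,
    (x < y) <==> (EX z, (z != 0) && (y == z + x)))).

(** All quantifiers are of the form "for all x < t" or "exists x < t"; [tshift]
    ensures that x does not occur in t. *)
Inductive bounded : form -> Prop :=
| b_eq a b : bounded (Eq a b)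
| b_lt a b : bounded (Lt a b)
| b_bot : bounded Bot
| b_imp A B : bounded A -> bounded B -> bounded (Imp A B)
| b_all t A : bounded A -> bounded (All (Imp (Lt (Var 0) (tshift t)) A))
| b_ex t A : bounded A -> bounded (Ex (And (Lt (Var 0) (tshift t)) A)).

(** [alternating k true] (resp. [false]): k alternating quantifiers, the first of
    which is existential (resp. universal), in front of a bounded formula. *)
Fixpoint alternating (k : nat) (existential : bool) (A : form) : Prop :=
  if k is k'.+1 then
    exists B, A = (if existential then Ex B else All B) /\
              alternating k' (~~ existential) B
  else bounded A.

Definition Sigma0 (k : nat) (A : form) : Prop :=
  exists B, alternating k true B /\ logically_equivalent A B.

(** Induction on variable 0. *)
Definition induction_form (A : form) : form :=
  Imp (And (inst Zero A)
           (All (Imp A (subst (scons (Add (Var 0) One) (fun i => Var i.+1)) A))))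
      (All A).

Inductive ISigma (k : nat) : form -> Prop :=
| IS_PA0 A : PA0 A -> ISigma k A
| IS_ind p A : Sigma0 k A -> below p.+1 A ->
    ISigma k (iter p All (induction_form A)).

(** A number codes a finite sequence of numbers by means of Cantor's pairing
    function and Goedel's beta function: if c codes the pair (a, b), then the ith
    value of c is the remainder of a modulo 1 + (i+1)b; the 0th value is the
    length of the sequence coded by c and the following ones are its entries. *)

Definition Pair (c a b : tm) : fm :=
  (c + c == (a + b) * ((a + b) + 1) + (b + b))%fm.

Definition Beta (c i x : tm) : fm :=
  (EX a < c + 1, EX b < c + 1, Pair c a b && (x < 1 + (i + 1) * b) &&
    (EX q < a + 1, a == q * (1 + (i + 1) * b) + x))%fm.

Definition Len (c l : tm) : fm := Beta c 0%fm l.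

(** Entries are numbered from 0. *)
Definition Entry (c i x : tm) : fm := Beta c (i + 1)%fm x.

(** The letter sigma_i is coded by i. *)
Definition Word (c : tm) : fm :=
  (EX l < c + 1, Len c l &&
    (ALL i < l, Entry c i 1 || Entry c i 2))%fm.

(** Codes of sequences are not unique. *)
Definition Same (u v : tm) : fm :=
  (EX l, Len u l && Len v l &&
    (ALL i < l, EX x, Entry u i x && Entry v i x))%fm.

(** u and v are obtained from each other by replacing one factor
    sigma_1 sigma_2 sigma_1 by sigma_2 sigma_1 sigma_2, or vice versa. *)
Definition Move (u v : tm) : fm :=
  let at3 (c j x y z : tm) :=
    (Entry c j x && Entry c (j + 1) y && Entry c (j + 2) z)%fm in
  (EX l, Len u l && Len v l &&
    (EX j < l, (j + 2 < l) &&
      (at3 u j 1 2 1 && at3 v j 2 1 2 || at3 u j 2 1 2 && at3 v j 1 2 1) &&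
      (ALL i < l, (i < j) || (j + 2 < i) ==>
        (EX x, Entry u i x && Entry v i x))))%fm.

(** s is a sequence u = s_0, ..., s_n = v of codes of words, each obtained from
    the previous one by at most one application of the defining relation. *)
Definition SameBraid (u v : tm) : fm :=
  (EX s, EX n, Len s (n + 1) && Entry s 0 u && Entry s n v &&
    (ALL i < n, EX x, EX y,
      Entry s i x && Entry s (i + 1) y && (Same x y || Move x y)))%fm.

Definition TrivialBraid (u : tm) : fm :=
  (EX v, Len v 0 && SameBraid u v)%fm.

(** In the formulas below, exponent sequences are coded with the rightmost block
    first, so that entry k is the exponent e_(k+1) of sigma_[k+1], and positions
    of blocks are likewise shifted by one. *)

(** w is the word with exponents e: the block of index k occupies the positions
    i of w, counted from the left, with x <= i < z, where z and x are the entries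
    k and k+1 of the sequence f. *)
Definition WordOfBlocks (w e : tm) : fm :=
  (EX l, EX p, EX f, Len w l && Len e p && Len f (p + 1) &&
    Entry f 0 l && Entry f p 0 &&
    (ALL k < p, EX x, EX y, EX z,
      Entry f (k + 1) x && Entry e k y && Entry f k z && (z == x + y) &&
      (ALL i < z, (x <= i) ==>
        (EX h, (k == h + h) && Entry w i 1) ||
        (EX h, (k == h + h + 1) && Entry w i 2))))%fm.

(** Block decomposition of a nonempty word: the number of blocks is minimal when
    all blocks, except possibly the rightmost of several blocks, are nonempty. *)
Definition BlockDecomposition (w e : tm) : fm :=
  (WordOfBlocks w e && (EX p, Len e p && (0 < p) &&
    (ALL k < p, (0 < k) || (k + 1 == p) ==>
      (EX y, Entry e k y && (0 < y)))))%fm.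

Definition Emin (k m : tm) : fm :=
  ((k == 0) && (m == 0) || (k == 1) && (m == 1) || (1 < k) && (m == 2))%fm.

Definition PhiNormal (w e : tm) : fm :=
  (BlockDecomposition w e && (EX p, Len e p &&
    (ALL k < p, (k + 1 < p) ==>
      (EX y, EX m, Entry e k y && Emin k m && (m <= y)))))%fm.

Definition Critical (e r : tm) : fm :=
  (EX p, Len e p && (r < p) &&
    (ALL k < r, EX y, EX m, Entry e k y && Emin k m && ~~ (m < y)) &&
    ((r + 1 == p) || (EX y, EX m, Entry e r y && Emin r m && (m < y))))%fm.

Definition ReduceBlocks (e t e' : tm) : fm :=
  (EX p, EX r, Len e p && Len e' p && Critical e r &&
    (ALL k < p, EX y, EX z, Entry e k y && Entry e' k z &&
      ((k == r) && (y == z + 1) ||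
       (k + 1 == r) && (z == y + t) ||
       (k != r) && (k + 1 != r) && (z == y))))%fm.

(** As PhiNormal words are nonempty, u does not represent 1. *)
Definition BraidStep (u t v : tm) : fm :=
  (EX w, EX e, EX e', EX w', SameBraid u w && PhiNormal w e &&
    ReduceBlocks e t e' && WordOfBlocks w' e' && SameBraid w' v)%fm.

Definition G3StopsAt (u n : tm) : fm :=
  (EX s, Len s (n + 1) && Entry s 0 u &&
    (ALL t < n, EX x, EX y,
      Entry s t x && Entry s (t + 1) y && BraidStep x (t + 1) y) &&
    (EX x, Entry s n x && TrivialBraid x))%fm.

Definition G3_stops_at_form : form := formula (G3StopsAt (fvar 0) (fvar 1)).

Definition G3_finite_form : form :=
  formula (ALL u, Word u ==> (EX n, G3StopsAt u n)).

(** The coding of words used by [Word]. *)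
Definition codes_word (c : nat) (w : word) : Prop :=
  exists a b, [/\ c + c = (a + b) * (a + b + 1) + (b + b),
    a %% (1 + 1 * b) = size w
  & forall i, i < size w ->
      a %% (1 + (i + 2) * b) = if nth true w i == sigma 1 then 1 else 2].

(* Main.v *)
(** Left multiplication by a letter acts on exponent sequences of normal words
    compatibly with the braid relation, whence the uniqueness of normal forms and
    the determinism of G3-sequences. A block [r] with one letter in excess above
    minimal blocks takes an Ackermannian time to be consumed.

    For the unprovability, a chain [a_0 < ... < a_k] is found between (the code of)
    a suitable braid and the length of its G3-sequence, such that no Delta0 formula
    from a finite list, with parameters below [a_i], has its least witness between
    [a_(i+1)] and [a_k]; this is pigeonholing inside a primitive recursive bound.
    Ultrapower elements lying below some [a_i], [i] standard, then form a cut of a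
    nonstandard model of arithmetic. Witnesses of an existential formula at
    parameters below [a_i] can be taken below [a_(i+1)], which reduces Sigma1
    induction in the cut to the least number principle of the integers; but the
    length of the G3-sequence lies above the cut. *)

Require Import Defs.
From mathcomp Require Import boolp classical_sets filter.
From mathcomp Require Import all_boot zify.

Set Implicit Arguments.
Unset Strict Implicit.
Unset Printing Implicit Defensive.

(** * Normal forms *)

(** Two growth rates are compared. A braid whose sequence is longer than [wait q 0] is given by a
    word with a number of letters linear in [q], so its code is bounded by a function of [q]
    dominated by one fixed row of [wait], and the diagonal [wait q 0] catches up with any such
    function. The chain fits in between because each pigeonhole only counts pairs of a listed
    formula and a valuation below [a], a number polynomial in [a].

    A single chain serves finitely many formulas, parameters and indices, whereas the cut has to
    satisfy induction for all Sigma1 formulas. The ultraproduct is therefore taken over pairs of a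
    list and a length, in such a way that each formula and each standard index is eventually
    covered.

    The cut need not be elementary in the ultrapower, so truth is transferred only in the direction
    that the quantifiers allow: being a word passes from the coordinates to the cut, and stopping at
    [n] passes from the cut to the coordinates. *)

Fixpoint update_last (f : nat -> nat) (e : seq nat) : seq nat :=
  match e with
  | [::] => [::]
  | [:: x] => [:: f x]
  | x :: s => x :: update_last f s
  end.

Lemma update_last_rcons f s x : update_last f (rcons s x) = rcons s (f x).
Proof.
elim: s => //= y s IH; rewrite -IH.
by case: s {IH}.
Qed.

Definition above_min (s : seq nat) : bool :=
  match s with
  | _ :: y :: s' => (0 < y) && all (leq 2) s'
  | _ => true
  end.

Lemma above_minP s :
  reflect (forall i, i < size s -> emin i.+1 <= nth 0 s i) (above_min s).
Proof.
case: s => [|x [|y s]] /=; try by constructor; case.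
apply: (iffP andP) => [[y0 /(all_nthP 0) s2]|H].
  by case=> [|[|i]] //= ?; exact: s2.
split; first exact: (H 1).
by apply/(all_nthP 0) => i i_s; exact: (H i.+2).
Qed.

(** The empty list stands for the trivial braid, from which the action of words starts. *)
Definition normal_exps (e : seq nat) : bool :=
  if e is [::] then true
  else (0 < last 0 e) && above_min (take (size e).-1 e).

Lemma normal_rcons s x : normal_exps (rcons s x) = (0 < x) && above_min s.
Proof.
rewrite /normal_exps size_rcons /= last_rcons -cats1 take_size_cat //.
by case: s.
Qed.

(** Left multiplication by [Delta = sigma_1 sigma_2 sigma_1]. Moving right, [Delta] exchanges the
    two letters, which raises the index of each block that it crosses; it stops before the rightmost
    block, where [sigma_1^y Delta sigma_1^x = sigma_1^(y+1) sigma_2 sigma_1^(x+1)]. *)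
Definition delta_mul (e : seq nat) : seq nat :=
  match e with
  | [::] => [:: 1; 1; 1]
  | [:: x] => [:: x.+1; 1; 1]
  | x :: y :: s => [:: x.+1, 1, y.+1 & s]
  end.

(** The third case is [a b a^n w = b^(n-1) Delta w] when the top block is a
    single letter [b], with [Delta] then pushed to the right through [w]. *)
Definition letter_mul (a : letter) (e : seq nat) : seq nat :=
  if e is [::] then (if a then [:: 1] else [:: 0; 1])
  else if a == sigma (size e) then update_last S e
  else if emin (size e) <= last 0 e then rcons e 1
  else update_last predn (delta_mul (take (size e).-1 e)).

Lemma letter_mul_rcons a s x :
  letter_mul a (rcons s x) =
  if a == sigma (size s).+1 then rcons s x.+1
  else if emin (size s).+1 <= x then rcons (rcons s x) 1
  else update_last predn (delta_mul s).
Proof.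
have -> : letter_mul a (rcons s x) =
    if a == sigma (size (rcons s x)) then update_last S (rcons s x)
    else if emin (size (rcons s x)) <= last 0 (rcons s x) then rcons (rcons s x) 1
    else update_last predn
           (delta_mul (take (size (rcons s x)).-1 (rcons s x))).
  by rewrite /letter_mul; case: s.
rewrite size_rcons last_rcons update_last_rcons /=.
by rewrite -[in take _ _]cats1 take_size_cat.
Qed.

Arguments update_last : simpl never.
Arguments normal_exps : simpl never.
Arguments letter_mul : simpl never.

Lemma above_min_rcons s x :
  above_min (rcons s x) = above_min s && (emin (size s).+1 <= x).
Proof.
case: s => [|y [|z s]] //=; first by rewrite andbT.
by rewrite all_rcons; case: (0 < z); rewrite //= andbC.
Qed.


Lemma normal_letter_mul a e : normal_exps e -> normal_exps (letter_mul a e).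
Proof.
case/lastP: e => [|s x]; first by case: a.
rewrite normal_rcons letter_mul_rcons => /andP[x0 ms].
case: ifP => _; first by rewrite normal_rcons.
case: ifP => mx; first by rewrite normal_rcons above_min_rcons ms mx.
case: s ms mx => [|y [|z s]] //=; first by move=> _; rewrite x0.
(* The block that becomes the top one and loses a letter has exponent [z.+1] with [z > 0], or
   [u >= 2]; it stays positive. *)
case/lastP: s => [|s u]; first by rewrite /normal_exps /=; case: z.
rewrite -!rcons_cons update_last_rcons normal_rcons /=.
by rewrite all_rcons => /and3P[z0 u2 s2] _; rewrite s2 !andbT; case: u u2 => [|[]].
Qed.

(** The right-hand side does not depend on [a], so both sides of the braid relation act in the same
    way. *)
Lemma letter_mul_delta a e : normal_exps e ->
  letter_mul a (letter_mul (~~ a) (letter_mul a e)) = delta_mul e.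
Proof.
have sigmaS p b : (b == sigma p.+1) = (b != sigma p).
  by rewrite /sigma /=; case: b; case: odd.
have sigmaN p b : (~~ b == sigma p) = (b != sigma p).
  by rewrite /sigma; case: b; case: odd.
case/lastP: e => [|s x]; first by case: a.
rewrite normal_rcons => /andP[x0 ms].
have xm : (emin (size s).+1 <= x.+1) by move: x0; case: (size s) => [|[|]].
rewrite letter_mul_rcons; case: ifP => [/eqP aE|aE].
  rewrite letter_mul_rcons sigmaN aE eqxx /= xm.
  rewrite letter_mul_rcons size_rcons sigmaS eqxx /=.
  case: s xm ms {aE} => [|y [|z s]] //= xm ms.
  by rewrite -!rcons_cons update_last_rcons.
case: ifP => mx.
  rewrite letter_mul_rcons sigmaN size_rcons sigmaS aE /=.
  case: s xm ms aE mx => [|y [|z s]] //= xm ms aE mx.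
  - by case: a aE.
  - by case: a aE x mx {x0 xm} => // _ [].
  rewrite -!rcons_cons update_last_rcons letter_mul_rcons /= prednK // ifT //.
  by move: aE; rewrite /sigma /=; case: a; case: odd.
have x1 : x = 1 by move: x0 mx; case: x {xm} => [|[|x]] //; case: (size s) => [|[|]].
case: s ms mx xm aE => [|y [|z s]] //; first by rewrite x1.
case/lastP: s => [|s u] ms mx xm aE.
  rewrite /= /update_last /=.
  by case: z ms mx xm aE => [|[|z]] //= _ _ _; case: a; rewrite x1.
have u2 : 2 <= u by move: ms; rewrite /= all_rcons => /and3P[].
have -> : delta_mul [:: y, z & rcons s u] = rcons [:: y.+1, 1, z.+1 & s] u by [].
rewrite update_last_rcons letter_mul_rcons sigmaN.
have sizeE : size [:: y.+1, 1, z.+1 & s] = size [:: y, z & rcons s u].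
  by rewrite /= size_rcons.
rewrite sizeE ifT; last by rewrite aE.
rewrite letter_mul_rcons sizeE aE prednK; last by case: u u2 {ms mx xm aE sizeE}.
rewrite ifT //.
by rewrite x1.
Qed.

Lemma normal_foldr w e :
  normal_exps e -> normal_exps (foldr letter_mul e w).
Proof. by move=> ne; elim: w => //= a w; exact: normal_letter_mul. Qed.

Lemma braid_cong_foldr u v e : braid_cong u v -> normal_exps e ->
  foldr letter_mul e u = foldr letter_mul e v.
Proof.
move=> uv; elim: uv e => {u v} //.
- move=> e ne /=.
  by rewrite (@letter_mul_delta (sigma 1)) // (@letter_mul_delta (sigma 2)).
- by move=> u v _ IH e ne; rewrite IH.
- by move=> u v w _ IH1 _ IH2 e ne; rewrite IH1 // IH2.
- move=> u u' v v' _ IH1 _ IH2 e ne.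
  by rewrite !foldr_cat IH2 // IH1 //; exact: normal_foldr.
Qed.

Lemma word_of_blocks_rcons s x :
  word_of_blocks (rcons s x) = nseq x (sigma (size s).+1) ++ word_of_blocks s.
Proof.
rewrite /word_of_blocks size_rcons -[X in iota 1 X]addn1 iotaD rev_cat /= /block nth_rcons.
rewrite add1n /= ltnn eqxx; congr (_ ++ flatten _).
apply/eq_in_map => k; rewrite mem_rev mem_iota => /andP[k0 ks].
by rewrite nth_rcons; case: k k0 ks => // k _; rewrite add1n ltnS /= => ->.
Qed.

Lemma foldr_word_of_blocks e :
  normal_exps e -> foldr letter_mul [::] (word_of_blocks e) = e.
Proof.
elim/last_ind: e => // s x IH; rewrite normal_rcons => /andP[x0 ms].
rewrite word_of_blocks_rcons foldr_cat.
suff {x x0} grow n : letter_mul (sigma (size s).+1)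
    (foldr letter_mul [::] (word_of_blocks s)) = rcons s 1 -> 
    foldr letter_mul (foldr letter_mul [::] (word_of_blocks s))
      (nseq n.+1 (sigma (size s).+1)) = rcons s n.+1.
  case: x x0 => // x _; apply: grow.
  case/lastP: s IH ms => // s y; rewrite normal_rcons above_min_rcons.
  case: y => [|y] IH /andP[ms my].
    by case: s ms my {IH} => [|? [|]].
  rewrite IH ?ms // letter_mul_rcons size_rcons ifF ?my //.
  by rewrite /sigma /=; case: odd.
move=> base; elim: n => [|n IHn] //; rewrite -[nseq _ _]/(_ :: nseq n.+1 _).
by have -> a v e : foldr letter_mul e (a :: v) = letter_mul a (foldr letter_mul e v)
  by []; rewrite IHn letter_mul_rcons eqxx.
Qed.

Lemma normal_exps_inj e e' : normal_exps e -> normal_exps e' ->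
  braid_cong (word_of_blocks e) (word_of_blocks e') -> e = e'.
Proof.
move=> ne ne' ee'.
by rewrite -(foldr_word_of_blocks ne) -(foldr_word_of_blocks ne') (braid_cong_foldr ee').
Qed.

Lemma normal_expsP e : e <> [::] ->
  reflect (0 < last 0 e /\ forall i, i.+1 < size e -> emin i.+1 <= nth 0 e i)
          (normal_exps e).
Proof.
case/lastP: e => // s x _; rewrite normal_rcons last_rcons size_rcons.
apply: (iffP andP) => [[x0 /above_minP ms]|[x0 ms]]; split=> //.
  by move=> i; rewrite ltnS => i_s; rewrite nth_rcons i_s; exact: ms.
by apply/above_minP => i i_s; move: (ms i i_s); rewrite nth_rcons i_s.
Qed.

(** If [e] has exactly [k] blocks, its top letter is already [sigma k] and no block is opened. Hence
    normalizing never increases the number of blocks, which gives the minimality required of a block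
    decomposition. *)
Lemma size_letter_mul k e : normal_exps e -> 0 < k -> size e <= k ->
  size (letter_mul (sigma k) e) <= k.
Proof.
have size_update f s : size (update_last f s) = size s.
  by case/lastP: s => // s y; rewrite update_last_rcons !size_rcons.
case/lastP: e => [|s x] ne k0.
  by move=> _; rewrite /letter_mul; case: k k0 => [|[|k]] // _; case: sigma.
rewrite size_rcons letter_mul_rcons => sk; case: ifP => [_|kE].
  by rewrite size_rcons.
case: ifP => [_|xm].
  rewrite !size_rcons ltn_neqAle sk andbT.
  by apply: contraFneq kE => <-.
rewrite size_update; move: ne; rewrite normal_rcons => /andP[x0 _].
by case: s xm sk {kE} => [|y [|z s]] //=; rewrite x0.
Qed.

Lemma size_foldr_word_of_blocks e :
  size (foldr letter_mul [::] (word_of_blocks e)) <= size e.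
Proof.
elim/last_ind: e => // s x IH.
rewrite word_of_blocks_rcons foldr_cat size_rcons.
elim: x => [|x IHx]; first exact: leq_trans IH _.
by apply: size_letter_mul => //; do 2!apply: normal_foldr.
Qed.

Lemma size_word_of_blocks e : normal_exps e -> e <> [::] ->
  0 < size (word_of_blocks e).
Proof.
case/lastP: e => // s x; rewrite normal_rcons => /andP[x0 _] _.
by rewrite word_of_blocks_rcons size_cat size_nseq ltn_addr.
Qed.

Lemma phi_normalE w e :
  phi_normal w e <-> [/\ w = word_of_blocks e, e <> [::] & normal_exps e].
Proof.
split=> [[w0 [wE emin_size] me]|[-> e0 ne]]; last first.
  split.
  - by move=> w0; have := size_word_of_blocks ne e0; rewrite w0.
  - split=> // e' ee'; have := size_foldr_word_of_blocks e'.
    by rewrite -ee' foldr_word_of_blocks.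
  - move/(normal_expsP e0): ne => [_ me] [|k] //= ke; exact: me.
have e0 : e <> [::] by move=> e0; apply: w0; rewrite wE e0.
split=> //; apply/normal_expsP => //; split=> [|i ie]; last exact: me.
case/lastP: e e0 wE emin_size {me} => // s [|x] _ wE minE; rewrite last_rcons //.
have := minE s; rewrite wE word_of_blocks_rcons size_rcons ltnn /=.
by move=> /(_ erefl).
Qed.

(** The relation is homogeneous; in particular no nonempty word represents 1. *)
Lemma braid_cong_size u v : braid_cong u v -> size u = size v.
Proof.
elim=> {u v} //= [u v w _ -> _ -> //|u u' v v' _ uu' _ vv'].
by rewrite !size_cat uu' vv'.
Qed.

(** * Lengths of G3-sequences *)

Lemma criticalP e : e <> [::] ->
  [/\ 0 < critical e <= size e,
      forall k, 0 < k < critical e -> block e k <= emin k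
    & critical e = size e \/ emin (critical e) < block e (critical e)].
Proof.
move=> e0; set P := fun k => emin k < block e k.
set s := iota 1 (size e).-1.
have se : (size e).-1.+1 = size e by case: (e) e0.
have ss : size s = (size e).-1 by rewrite size_iota.
have fs : find P s <= (size e).-1 by rewrite -ss find_size.
have critE : critical e = (find P s).+1 by [].
rewrite critE -{1 2}se !ltnS fs; split=> // [k /andP[k0]|].
  rewrite ltnS => kf; rewrite leqNgt; apply/negP => Pk.
  have kf' : k.-1 < find P s by rewrite prednK.
  have := before_find 0 kf'; rewrite nth_iota; last exact: leq_trans kf' fs.
  by rewrite add1n prednK // /P Pk.
move: fs; rewrite leq_eqVlt => /orP[/eqP ->|fs]; first by left.
right; have := fs; rewrite -ss -has_find => /(nth_find 0).
by rewrite nth_iota.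
Qed.

Lemma critical_unique e r : 0 < r <= size e ->
  (forall k, 0 < k < r -> block e k <= emin k) ->
  r = size e \/ emin r < block e r -> critical e = r.
Proof.
move=> /andP[r0 re] below_r at_r.
have e0 : e <> [::] by move=> e0; move: re r0; rewrite e0; case: r {below_r at_r}.
have [/andP[c0 ce] below_c at_c] := criticalP e0.
case: (ltngtP (critical e) r) => // [cr|rc].
  case: at_c => [cE|]; first by move: cr; rewrite cE ltnNge re.
  by rewrite ltnNge below_r // c0.
case: at_r => [rE|]; first by move: rc; rewrite rE ltnNge ce.
by rewrite ltnNge below_c // r0.
Qed.

Lemma size_reduce_blocks e t : size (reduce_blocks e t) = size e.
Proof. by rewrite size_map size_iota. Qed.

Lemma nth_reduce_blocks e t i : i < size e ->
  nth 0 (reduce_blocks e t) i =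
  if i.+1 == critical e then (nth 0 e i).-1
  else if i.+2 == critical e then nth 0 e i + t else nth 0 e i.
Proof.
by move=> ie; rewrite (nth_map 0) ?size_iota // nth_iota.
Qed.

(** Letters are only added strictly below the critical block, hence never to the top block. *)
Lemma last_reduce_blocks e t : last 0 (reduce_blocks e t) <= last 0 e.
Proof.
case: (eqVneq e [::]) => [-> //|/eqP e0].
have se : (size e).-1.+1 = size e by case: (e) e0.
rewrite -!nth_last size_reduce_blocks nth_reduce_blocks ?se //.
have [/andP[_ ce] _ _] := criticalP e0.
by case: ifP => _; rewrite ?leq_pred // ifF //; apply: contraTF ce => /eqP <-; rewrite ltnn.
Qed.

Lemma reduce_blocks_above_min e t :
  (forall i, i.+1 < size e -> emin i.+1 <= nth 0 e i) ->
  forall i, i.+1 < size e -> emin i.+1 <= nth 0 (reduce_blocks e t) i.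
Proof.
move=> me i ie; have e0 : e <> [::] by move=> e0; rewrite e0 in ie.
rewrite nth_reduce_blocks; last exact: ltnW.
case: ifP => [/eqP iE|_]; last first.
  by case: ifP => _; rewrite ?(leq_trans (me i ie)) ?leq_addr // me.
have [_ _] := criticalP e0; rewrite -iE => -[iE'|]; first by rewrite iE' ltnn in ie.
by rewrite /block /=; case: nth.
Qed.

Lemma braid_step_reduce e t b : normal_exps e -> e <> [::] ->
  braid_step (braid_of (word_of_blocks e)) t b ->
  b = braid_of (word_of_blocks (reduce_blocks e t)).
Proof.
move=> ne e0 [w [e' [/braid_ofP ww' /phi_normalE[wE e'0 ne'] ->]]].
by rewrite wE in ww'; rewrite (normal_exps_inj ne ne' ww').
Qed.

(** A block at position [r + 1] with one letter in excess, above minimal blocks,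
    consumes it between times [t] and [wait r t]. *)
Fixpoint wait (r t : nat) : nat :=
  if r is r'.+1 then iter t.+1 (wait r') t.+1 else t.+1.

Definition timed_reduce (p : seq nat * nat) : seq nat * nat :=
  (reduce_blocks p.1 p.2.+1, p.2.+1).

Lemma iter_timed_reduce2 n p : (iter n timed_reduce p).2 = p.2 + n.
Proof. by elim: n => [|n IH]; rewrite ?addn0 //= IH addnS. Qed.

(** Here [r] counts from 0. Removing the excess letter at step [t.+1] puts [t.+1] excess letters on
    the block below; [loop] consumes them one by one through the induction hypothesis, which is the
    recursion defining [wait]. The top block stays untouched since [r.+1 < size e]. *)
Lemma wait_timed_reduce r e t : r.+1 < size e ->
  (forall i, i < r -> nth 0 e i = emin i.+1) -> emin r.+1 < nth 0 e r ->
  exists n, iter n timed_reduce (e, t) =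
    (set_nth 0 e r (nth 0 e r).-1, wait r t).
Proof.
elim: r e t => [|r IH] e t re mine er.
  exists 1; congr (_, _); apply: (@eq_from_nth _ 0).
    by rewrite size_reduce_blocks size_set_nth (maxn_idPr (ltnW re)).
  move=> i; rewrite size_reduce_blocks => ie; rewrite nth_reduce_blocks // nth_set_nth /=.
  have -> : critical e = 1.
    apply: critical_unique => [|[|k]//|]; last by right.
    by rewrite (leq_ltn_trans _ re).
  by case: i ie.
have crit : critical e = r.+2.
  apply: critical_unique; [exact: ltnW | | by right].
  by case=> // k /andP[_]; rewrite /block /= ltnS => kr; rewrite mine.
set e1 := reduce_blocks e t.+1.
have e1E i : i < size e -> nth 0 e1 i = if i == r.+1 then (nth 0 e i).-1
    else if i == r then emin i.+1 + t.+1 else nth 0 e i.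
  move=> ie; rewrite nth_reduce_blocks // crit !eqSS.
  by do 2![case: ifP => //] => /eqP ->; rewrite mine.
have size1 : size e1 = size e by rewrite size_reduce_blocks.
have re' : r.+1 < size e by exact: ltnW.
suff loop m f s : size f = size e -> (forall i, i < r -> nth 0 f i = emin i.+1) ->
    nth 0 f r = emin r.+1 + m ->
    exists n, iter n timed_reduce (f, s) = (set_nth 0 f r (emin r.+1), iter m (wait r) s).
  have [] := loop t.+1 e1 t.+1 size1.
  - move=> i ir; rewrite e1E; last exact: ltn_trans ir (ltnW re').
    by rewrite !ltn_eqF ?mine // ltnW.
  - by rewrite e1E ?(ltnW re') // eqxx ltn_eqF.
  move=> n nE; exists (n + 1); rewrite iterD /= -[timed_reduce _]/(e1, t.+1) nE.
  congr (_, _); apply: (@eq_from_nth _ 0).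
    by rewrite !size_set_nth size1 !(maxn_idPr _) // ltnW.
  move=> i; rewrite size_set_nth size1 (maxn_idPr (ltnW re')) => ie.
  rewrite !nth_set_nth /= e1E //.
  case: (eqVneq i r) => [->|_]; first by rewrite ltn_eqF // mine.
  by case: eqP => [->|].
elim: m f s => [|m IHm] f s sf minf fr.
  exists 0 => /=; congr (_, _); apply: (@eq_from_nth _ 0).
    by rewrite size_set_nth sf (maxn_idPr (ltnW re')).
  by move=> i _; rewrite nth_set_nth /=; case: eqP => // ->; rewrite fr addn0.
have [||| n nE] := IH f s; rewrite ?sf ?fr //; first by rewrite addnS ltnS leq_addr.
have [||| n' n'E] := IHm (set_nth 0 f r (nth 0 f r).-1) (wait r s).
- by rewrite size_set_nth sf (maxn_idPr (ltnW re')).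
- by move=> i ir; rewrite nth_set_nth /= ltn_eqF // minf.
- by rewrite nth_set_nth /= eqxx fr addnS.
exists (n' + n); rewrite iterD nE n'E iterSr; congr (_, _).
by rewrite set_set_nth eqxx.
Qed.

(** The final 1 is a top block above the block with the excess letter, so that this excess is
    consumed below the top while the word remains nontrivial. *)
Definition slow_exps (q : nat) : seq nat :=
  rcons (rcons [seq emin i.+1 | i <- iota 0 q] (emin q.+1).+1) 1.

Lemma slow_exps_long q n :
  G3_stops_at (braid_of (word_of_blocks (slow_exps q))) n -> wait q 0 < n.
Proof.
set e := slow_exps q => -[s [s0 step sn]].
have size_e : size e = q.+2 by rewrite !size_rcons size_map size_iota.
have mine i : i < q -> nth 0 e i = emin i.+1.
  move=> iq; rewrite !nth_rcons size_rcons size_map size_iota iq ltnS (ltnW iq).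
  by rewrite (nth_map 0) ?size_iota // nth_iota.
have eq : nth 0 e q = (emin q.+1).+1.
  by rewrite !nth_rcons size_rcons size_map size_iota ltnSn ltnn eqxx.
have laste : last 0 e = 1 by rewrite last_rcons.
have [|||N NE] := @wait_timed_reduce q e 0; rewrite ?size_e ?eq //.
have NT : N = wait q 0 by have := iter_timed_reduce2 N (e, 0); rewrite NE add0n => <-.
pose f m := (iter m timed_reduce (e, 0)).1.
have fS m : f m.+1 = reduce_blocks (f m) m.+1.
  by rewrite /f /= iter_timed_reduce2 add0n.
have size_f m : size (f m) = q.+2.
  by elim: m => [|m IH] //; rewrite fS size_reduce_blocks.
have f0 m : f m <> [::] by move=> fm; have := size_f m; rewrite fm.
have above m i : i.+1 < size (f m) -> emin i.+1 <= nth 0 (f m) i.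
  elim: m i => [|m IH]; last first.
    by rewrite fS size_reduce_blocks; exact: reduce_blocks_above_min.
  rewrite -[f 0]/e size_e => i; rewrite !ltnS leq_eqVlt => /orP[/eqP ->|/mine -> //].
  by rewrite eq.
have lastN : last 0 (f N) = 1.
  rewrite /f NE -nth_last size_set_nth size_e (maxn_idPr _) //= nth_set_nth /=.
  by rewrite gtn_eqF // -[RHS]laste -nth_last size_e.
(* The top exponent never increases, so its value 1 at time [N] makes it positive at all earlier
   times. *)
have last_pos m : m <= N -> 0 < last 0 (f m).
  move=> mN; rewrite -(subnK mN) in lastN.
  have -> : 1 = last 0 (f (N - m + m)) by [].
  elim: (N - m) {lastN mN} => // d; rewrite addSn fS; apply: leq_trans.
  exact: last_reduce_blocks.
have norm m : m <= N -> normal_exps (f m).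
  by move=> mN; apply/normal_expsP => //; split; [exact: last_pos | exact: above].
have sE m : m <= N -> m <= n -> s m = braid_of (word_of_blocks (f m)).
  elim: m => [|m IH] mN mn; first by rewrite s0.
  have [_] := step m mn; rewrite IH ?(ltnW mn) ?(ltnW mN) // fS.
  exact: (braid_step_reduce (norm m (ltnW mN))).
rewrite ltnNge -NT; apply/negP => nN.
have := sE n nN (leqnn n); rewrite sn => /braid_ofP /braid_cong_size /esym.
by apply/eqP; rewrite -lt0n; apply: size_word_of_blocks => //; exact: norm.
Qed.

(** * Coding of sequences *)

(** The inverse of Cantor's pairing function, computed by walking along the antidiagonals. *)
Fixpoint unpair (c : nat) : nat * nat :=
  if c is c'.+1 then
    let: (a, b) := unpair c' in if a is a'.+1 then (a', b.+1) else (b.+1, 0)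
  else (0, 0).

Lemma unpairE c a b :
  c + c = (a + b) * (a + b + 1) + (b + b) <-> unpair c = (a, b).
Proof.
have spec d : d + d = ((unpair d).1 + (unpair d).2) *
    ((unpair d).1 + (unpair d).2 + 1) + ((unpair d).2 + (unpair d).2).
  elim: d => //= d; case: (unpair d) => [[|x] y] /= IH; nia.
split=> [cE|uE]; last by rewrite spec uE.
have := spec c; case: (unpair c) => x y /=; rewrite cE => E.
have s_eq : a + b = x + y by case: (ltngtP (a + b) (x + y)) => // H; nia.
have -> : y = b by move: E; rewrite s_eq; lia.
by congr (_, _); lia.
Qed.

Definition beta (c i : nat) : nat :=
  (unpair c).1 %% (1 + (i + 1) * (unpair c).2).

Definition decode (c : nat) : seq nat := mkseq (fun i => beta c (i + 1)) (beta c 0).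

Lemma chinese_seq (m r : nat -> nat) n :
  (forall i j, i < j < n -> coprime (m i) (m j)) ->
  (forall i, i < n -> r i < m i) ->
  exists2 a, a < \prod_(i < n) m i & forall i, i < n -> a %% m i = r i.
Proof.
elim: n => [|n IH] cop rm; first by exists 0; rewrite ?big_ord0.
have [||a am ar] := IH.
- by move=> i j /andP[ij jn]; rewrite cop // ij ltnW.
- by move=> i i_n; rewrite rm // ltnW.
set P := \prod_(i < n) m i in am *.
have copP : coprime P (m n).
  rewrite /P coprime_sym; apply: (big_ind (fun x => coprime (m n) x)) => //.
  - exact: coprimen1.
  - by move=> x y; rewrite coprimeMr => -> ->.
  - by move=> i _; rewrite coprime_sym cop // ltn_ord /=.
have P0 : 0 < P by exact: leq_ltn_trans am.
have m0 : 0 < m n by exact: leq_ltn_trans (rm n _).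
exists (chinese P (m n) a (r n) %% (P * m n)).
  by rewrite big_ord_recr /= -/P ltn_mod muln_gt0 P0.
move=> i; rewrite ltnS leq_eqVlt => /orP[/eqP ->|i_n].
  by rewrite modn_dvdm ?dvdn_mull // chinese_modr // modn_small ?rm.
rewrite -(ar i i_n) modn_dvdm; last first.
  by rewrite dvdn_mulr // /P (bigD1 (Ordinal i_n)) //= dvdn_mulr.
have mP : m i %| P by rewrite /P (bigD1 (Ordinal i_n)) //= dvdn_mulr.
by rewrite -(modn_dvdm _ mP) chinese_modl // modn_dvdm.
Qed.

(** The second component of the code is [n!], and the power bounds the product of the moduli, hence
    the first component. The bound is explicit because the growth argument needs a slowly growing
    bound on codes. *)
Definition code_bound (n : nat) : nat :=
  let m := (1 + (n + 1) * n`!) ^ (n + 1) + n`! in (m + m) * (m + m + 1) + (m + m).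

(** Goedel's moduli [1 + (i+1) N!] for [i < n <= N] are pairwise coprime. *)
Lemma encode_bounded n N (f : nat -> nat) :
  n < N -> (forall i, i < n -> f i < N) ->
  exists c, [/\ c <= code_bound N, beta c 0 = n
    & forall i, i < n -> beta c (i + 1) = f i].
Proof.
move=> nN fN; set b := N`!.
pose g i := if i is i'.+1 then f i' else n.
have bN : N <= b.
  rewrite /b; case: N {nN fN b} => // N; rewrite factS.
  by rewrite leq_pmulr // fact_gt0.
have [||a aP aE] := @chinese_seq (fun i => 1 + (i + 1) * b) g n.+1.
- move=> i j /andP[ij jn]; set x := _ + _; set y := _ + _.
  set d := gcdn x y; have dx : d %| x := dvdn_gcdl x y.
  have copb : coprime d b.
    apply: coprime_dvdl dx _.
    by rewrite /x coprime_sym /coprime addnC gcdnMDl gcdn1.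
  have : d %| y - x by apply: dvdn_sub => //; exact: dvdn_gcdr.
  have -> : y - x = (j - i) * b by rewrite /x /y; nia.
  rewrite Gauss_dvdl // => dji.
  have db : d %| b.
    apply: dvdn_trans dji _; apply: dvdn_fact; lia.
  by move: copb; rewrite /coprime (gcdn_idPl db).
- case=> [|i] /= i_n; first by nia.
  have : f i < N by exact: fN.
  nia.
exists ((a + b) * (a + b + 1) %/ 2 + b).
set c := _ + b; have cE : c + c = (a + b) * (a + b + 1) + (b + b).
  suff : (a + b) * (a + b + 1) %/ 2 * 2 = (a + b) * (a + b + 1) by lia.
  apply/eqP; rewrite -[_ == _]dvdn_eq; rewrite dvdn2 oddM !oddD /=.
  by case: (odd a); case: (odd b).
have uE : unpair c = (a, b) by apply/unpairE.
split; last 2 first.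
- by rewrite /beta uE /= (aE 0).
- by move=> i i_n; rewrite /beta uE /= addn1 (aE i.+1).
have aM : a <= (1 + (N + 1) * b) ^ (N + 1).
  apply: leq_trans (ltnW aP) _.
  apply: leq_trans (_ : \prod_(i < n.+1) (1 + (N + 1) * b) <= _).
    by apply: leq_prod => i _; rewrite leq_add2l leq_mul2r; have := ltn_ord i; lia.
  rewrite big_const_ord iter_muln_1 leq_exp2l; lia.
rewrite /code_bound -/b; move: aM; set M := _ ^ _ => aM; nia.
Qed.

(** * Semantics of the arithmetic formulas *)

(** [denotes t d rho v]: under the valuation [rho] of [d] enclosing quantifiers, the
    HOAS term [t] denotes [v], at depth [d] and at all larger depths. *)
Definition denotes (t : tm) (d : nat) (rho : nat -> nat) (v : nat) : Prop :=
  forall xs : seq nat, teval (foldr scons rho xs) (t (d + size xs)) = v.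

Definition sat (A : fm) (d : nat) (rho : nat -> nat) (P : Prop) : Prop :=
  holds rho (A d) <-> P.

Lemma foldr_scons (rho : nat -> nat) (xs : seq nat) i : foldr scons rho xs (size xs + i) = rho i.
Proof. by elim: xs. Qed.

Lemma denotes_bvar d rho x : denotes (bvar d) d.+1 (scons x rho) x.
Proof.
by move=> xs; rewrite /bvar addKn /= -[size xs]addn0 foldr_scons.
Qed.

Lemma denotes_scons t d rho v x : denotes t d rho v -> denotes t d.+1 (scons x rho) v.
Proof.
by move=> tv xs; have := tv (rcons xs x); rewrite size_rcons addnS -addSn foldr_rcons.
Qed.

Lemma denotes_fvar d i rho : denotes (fvar i) d rho (rho (d + i)).
Proof.
by move=> xs; rewrite /fvar /= [d + _]addnC -addnA foldr_scons.
Qed.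

Lemma denotes_zero d rho : denotes tzero d rho 0. Proof. by []. Qed.
Lemma denotes_one d rho : denotes tone d rho 1. Proof. by []. Qed.

Lemma denotes_add a b d rho x y :
  denotes a d rho x -> denotes b d rho y -> denotes (tadd a b) d rho (x + y).
Proof. by move=> ax b_y xs; rewrite /= ax b_y. Qed.

Lemma denotes_mul a b d rho x y :
  denotes a d rho x -> denotes b d rho y -> denotes (tmul a b) d rho (x * y).
Proof. by move=> ax b_y xs; rewrite /= ax b_y. Qed.

Lemma denotes_teval t d rho v : denotes t d rho v -> teval rho (t d) = v.
Proof. by move=> /(_ [::]); rewrite addn0. Qed.

Lemma sat_eq a b d rho x y :
  denotes a d rho x -> denotes b d rho y -> sat (feq a b) d rho (x = y).
Proof. by move=> /denotes_teval ax /denotes_teval b_y; rewrite /sat /= ax b_y. Qed.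

Lemma sat_lt a b d rho x y :
  denotes a d rho x -> denotes b d rho y -> sat (flt a b) d rho (x < y).
Proof. by move=> /denotes_teval ax /denotes_teval b_y; rewrite /sat /= ax b_y. Qed.

Lemma sat_not A d rho P : sat A d rho P -> sat (fnot A) d rho (~ P).
Proof. by rewrite /sat /= => ->. Qed.

Lemma sat_imp A B d rho P Q :
  sat A d rho P -> sat B d rho Q -> sat (fimp A B) d rho (P -> Q).
Proof. by rewrite /sat /= => -> ->. Qed.

Lemma sat_and A B d rho P Q :
  sat A d rho P -> sat B d rho Q -> sat (fand A B) d rho (P /\ Q).
Proof.
by rewrite /sat /= => -> ->; split=> [H|[p q]]; [apply: contrapT => npq; apply: H => p q; exact: npq|apply].
Qed.

Lemma sat_or A B d rho P Q :
  sat A d rho P -> sat B d rho Q -> sat (for_ A B) d rho (P \/ Q).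
Proof.
rewrite /sat /= => -> ->; split=> [H|[p np|//]]; last exact: False_ind (np p).
by have [|/H] := EM P; [left | right].
Qed.

Lemma sat_all F d rho P :
  (forall x, sat (F (bvar d)) d.+1 (scons x rho) (P x)) ->
  sat (fall F) d rho (forall x, P x).
Proof. by move=> FP; split=> H x; apply/FP. Qed.

Lemma sat_ex F d rho P :
  (forall x, sat (F (bvar d)) d.+1 (scons x rho) (P x)) ->
  sat (fex F) d rho (exists x, P x).
Proof.
move=> FP; split=> [H|[x Px] H]; last by apply: (H x); apply/FP.
by apply: contrapT => nP; apply: H => x /FP Px; apply: nP; exists x.
Qed.

Lemma sat_iff A d rho P Q : (P <-> Q) -> sat A d rho P -> sat A d rho Q.
Proof. by rewrite /sat => -> . Qed.


Ltac denote :=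
  lazymatch goal with
  | |- denotes (tadd _ _) _ _ _ => refine (denotes_add _ _); denote
  | |- denotes (tmul _ _) _ _ _ => refine (denotes_mul _ _); denote
  | |- denotes tzero _ _ _ => exact: denotes_zero
  | |- denotes tone _ _ _ => exact: denotes_one
  | |- denotes (bvar ?d) (S ?d) (scons _ _) _ => exact: denotes_bvar
  | |- denotes _ _ _ _ =>
    first [eassumption | refine (denotes_scons _ _); denote]
  end.

Ltac sat_leaf := fail.

Ltac saturate :=
  lazymatch goal with
  | |- sat (fex _) _ _ _ => refine (sat_ex _) => ?; saturate
  | |- sat (fall _) _ _ _ => refine (sat_all _) => ?; saturate
  | |- sat (fand _ _) _ _ _ => refine (sat_and _ _); saturate
  | |- sat (for_ _ _) _ _ _ => refine (sat_or _ _); saturate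
  | |- sat (fimp _ _) _ _ _ => refine (sat_imp _ _); saturate
  | |- sat (fnot _) _ _ _ => refine (sat_not _); saturate
  | |- sat (feq _ _) _ _ _ => refine (sat_eq _ _); denote
  | |- sat (flt _ _) _ _ _ => refine (sat_lt _ _); denote
  | |- sat _ _ _ _ => sat_leaf; denote
  end.


Lemma sat_pair c a b d rho vc va vb :
  denotes c d rho vc -> denotes a d rho va -> denotes b d rho vb ->
  sat (Pair c a b) d rho (unpair vc = (va, vb)).
Proof.
by move=> cv av bv; apply: sat_iff; [exact: unpairE | rewrite /Pair; saturate].
Qed.
Ltac sat_leaf ::= refine (sat_pair _ _ _).

Lemma unpair_le c : (unpair c).1 <= c /\ (unpair c).2 <= c.
Proof.
have [uE _] := unpairE c (unpair c).1 (unpair c).2.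
have := proj2 (unpairE c (unpair c).1 (unpair c).2).
case: (unpair c) {uE} => a b /= /(_ erefl); nia.
Qed.

Lemma sat_beta c i x d rho vc vi vx :
  denotes c d rho vc -> denotes i d rho vi -> denotes x d rho vx ->
  sat (Beta c i x) d rho (beta vc vi = vx).
Proof.
move=> cv iv xv; apply: sat_iff; last by rewrite /Beta; saturate.
rewrite /= /beta; split=> [[a [_ [b [_ [[-> xb] [q [_ ->]]]]]]]|<-].
  by rewrite /= modnMDl modn_small.
have [uc1 uc2] := unpair_le vc.
exists (unpair vc).1; rewrite addn1 ltnS; split=> //.
exists (unpair vc).2; rewrite ltnS; split=> //; split.
  by split; [case: (unpair vc) | rewrite ltn_mod addnC addn1].
exists ((unpair vc).1 %/ (1 + (vi + 1) * (unpair vc).2)).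
by rewrite [_.1 + 1]addn1 ltnS leq_div -divn_eq.
Qed.
Ltac sat_leaf ::= first [refine (sat_pair _ _ _) | refine (sat_beta _ _ _)].

Definition len (c : nat) : nat := beta c 0.
Definition entry (c i : nat) : nat := beta c (i + 1).

Lemma size_decode c : size (decode c) = len c.
Proof. by rewrite size_mkseq. Qed.

Lemma nth_decode c i : i < len c -> nth 0 (decode c) i = entry c i.
Proof. by move=> ic; rewrite nth_mkseq. Qed.

Lemma decode_eq c s : len c = size s ->
  (forall i, i < size s -> entry c i = nth 0 s i) -> decode c = s.
Proof.
move=> cs H; apply: (@eq_from_nth _ 0); rewrite size_decode // => i ic.
by rewrite nth_decode // H // -cs.
Qed.

Lemma len_le c : len c <= c.
Proof. by rewrite (leq_trans (leq_mod _ _)) // (unpair_le c).1. Qed.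

Lemma sat_len c l d rho vc vl : denotes c d rho vc -> denotes l d rho vl ->
  sat (Len c l) d rho (len vc = vl).
Proof. by move=> cv lv; rewrite /Len /len; saturate. Qed.

Lemma sat_entry c i x d rho vc vi vx :
  denotes c d rho vc -> denotes i d rho vi -> denotes x d rho vx ->
  sat (Entry c i x) d rho (entry vc vi = vx).
Proof. by move=> cv iv xv; rewrite /Entry /entry; saturate. Qed.
Ltac sat_leaf ::= first [refine (sat_len _ _) | refine (sat_entry _ _ _)].

Lemma decode_surj s : exists c, decode c == s.
Proof.
pose N := (size s + \max_(i < size s) nth 0 s i).+1.
have [||c [_ cl ce]] := @encode_bounded (size s) N (nth 0 s).
- by rewrite /N ltnS leq_addr.
- move=> i i_s; rewrite /N ltnS; apply: leq_trans _ (leq_addl _ _).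
  exact: (@leq_bigmax _ (fun i : 'I_(size s) => nth 0 s i) (Ordinal i_s)).
by exists c; apply/eqP; exact: decode_eq.
Qed.

Definition encode (s : seq nat) : nat := xchoose (decode_surj s).

Lemma encodeK : cancel encode decode.
Proof. by move=> s; apply/eqP; exact: (xchooseP (decode_surj s)). Qed.

Lemma len_encode s : len (encode s) = size s.
Proof. by rewrite -size_decode encodeK. Qed.

Lemma entry_encode s i : i < size s -> entry (encode s) i = nth 0 s i.
Proof. by move=> i_s; rewrite -nth_decode ?len_encode // encodeK. Qed.

Lemma len_encode_mkseq f n : len (encode (mkseq f n)) = n.
Proof. by rewrite len_encode size_mkseq. Qed.

Lemma entry_encode_mkseq f n i : i < n -> entry (encode (mkseq f n)) i = f i.
Proof. by move=> i_n; rewrite entry_encode ?size_mkseq // nth_mkseq. Qed.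

Definition letter_code (a : letter) : nat := if a then 1 else 2.

Lemma letter_code_inj : injective letter_code.
Proof. by case=> [] []. Qed.

Definition codes (c : nat) (w : word) : Prop := decode c = map letter_code w.

Lemma codes_inj c w w' : codes c w -> codes c w' -> w = w'.
Proof. by rewrite /codes => -> /(inj_map letter_code_inj). Qed.

Lemma codes_len c w : codes c w -> len c = size w.
Proof. by rewrite -size_decode => ->; rewrite size_map. Qed.

Lemma codes_entry c w i : codes c w -> i < size w ->
  entry c i = letter_code (nth true w i).
Proof.
by move=> cw iw; rewrite -nth_decode ?(codes_len cw) // cw (nth_map true).
Qed.

Lemma codes_wordP c w : codes_word c w <-> codes c w.
Proof.
split=> [[a [b [/unpairE uE aw ai]]]|cw].
  apply: decode_eq; rewrite size_map /len /entry /beta uE //=.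
  move=> i iw; rewrite -addnA ai // (nth_map true) //.
  by case: (nth true w i).
exists (unpair c).1, (unpair c).2; split.
- by apply/unpairE; case: unpair.
- by rewrite -(codes_len cw).
move=> i iw; have := codes_entry cw iw; rewrite /entry /beta -addnA => ->.
by case: (nth true w i).
Qed.

Lemma sat_word c d rho vc : denotes c d rho vc ->
  sat (Word c) d rho (exists w, codes vc w).
Proof.
move=> cv; apply: sat_iff; last by rewrite /Word; saturate.
split=> [[l [_ [lE cE]]]|[w cw]].
  exists [seq entry vc i == 1 | i <- iota 0 l]; apply: decode_eq.
    by rewrite !size_map size_iota.
  rewrite !size_map size_iota => i il.
  rewrite (nth_map true) ?size_map ?size_iota // (nth_map 0) ?size_iota // nth_iota //.
  by case: (cE i il) => ->.
exists (len vc); rewrite addn1 ltnS len_le; split=> //; split=> // i.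
rewrite (codes_len cw) => iw; rewrite (codes_entry cw iw).
by case: nth; [left | right].
Qed.

Lemma sat_same u v d rho vu vv : denotes u d rho vu -> denotes v d rho vv ->
  sat (Same u v) d rho (decode vu = decode vv).
Proof.
move=> uv v_v; apply: sat_iff; last by rewrite /Same; saturate.
split=> [[l [[ul vl] E]]|E].
  apply: decode_eq; rewrite size_decode ?ul // vl // => i il.
  by have [x [ux vx]] := E i il; rewrite nth_decode ?vl // ux vx.
exists (len vu); rewrite -[len vv]size_decode -E size_decode; split=> // i iu; exists (entry vu i); split=> //.
by rewrite -!nth_decode ?E // -size_decode -E size_decode.
Qed.

(** * Rewriting of coded words by the braid relation *)

Definition relation_at (x y : seq nat) (j : nat) : Prop :=
  [/\ nth 0 x j = 1, nth 0 x (j + 1) = 2, nth 0 x (j + 2) = 1,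
      nth 0 y j = 2 & nth 0 y (j + 1) = 1 /\ nth 0 y (j + 2) = 2].

Definition moves (x y : seq nat) : Prop :=
  size x = size y /\ exists j, [/\ j + 2 < size x,
    relation_at x y j \/ relation_at y x j
  & forall i, i < size x -> i < j \/ j + 2 < i -> nth 0 x i = nth 0 y i].

Lemma sat_move u v d rho vu vv : denotes u d rho vu -> denotes v d rho vv ->
  sat (Move u v) d rho (moves (decode vu) (decode vv)).
Proof.
move=> uv v_v; apply: sat_iff; last by rewrite /Move; saturate.
rewrite /moves !size_decode -[1 + 1]/2; split=> [[l [[ul vl]]]|[E]] [j].
  case=> [jl [[jl2 uvE] E]]; rewrite ul vl; split=> //; exists j; split=> //.
    rewrite /relation_at !nth_decode ?ul ?vl; try lia.
    by case: uvE => -[[[? ?] ?] [[? ?] ?]]; [left | right].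
  move=> i il ij; have [x [ux vx]] := E i il ij.
  by rewrite !nth_decode ?ul ?vl // ux vx.
case=> jl; rewrite /relation_at !nth_decode -?E; try lia.
move=> uvE eqE; exists (len vu); split=> //; exists j; split; first lia.
split; first by split=> //; case: uvE => -[? ? ? ? [? ?]]; [left | right].
move=> i iu ij; exists (entry vu i); split=> //.
by rewrite -!nth_decode -?E // eqE.
Qed.
Ltac sat_leaf ::= first [refine (sat_len _ _) | refine (sat_entry _ _ _)
  | refine (sat_same _ _) | refine (sat_move _ _)].

Definition chain (x y : nat) (R : seq nat -> seq nat -> Prop) : Prop :=
  exists n (f : nat -> nat), [/\ f 0 = x, f n = y
    & forall i, i < n -> R (decode (f i)) (decode (f i.+1))].

Lemma sat_same_braid u v d rho vu vv :
  denotes u d rho vu -> denotes v d rho vv ->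
  sat (SameBraid u v) d rho (chain vu vv (fun x y => x = y \/ moves x y)).
Proof.
move=> uv v_v; apply: sat_iff; last by rewrite /SameBraid; saturate.
split=> [[s [n [[[sn s0] sn'] E]]]|[n [f [f0 fn E]]]].
  exists n, (entry s); split=> // i i_n; rewrite -addn1.
  by have [x [y [[-> ->]]]] := E i i_n.
exists (encode (mkseq f (n + 1))), n.
have entryE i : i <= n -> entry (encode (mkseq f (n + 1))) i = f i.
  by move=> i_n; rewrite entry_encode_mkseq // addn1 ltnS.
rewrite len_encode_mkseq !entryE //; split=> // i i_n; exists (f i), (f i.+1).
by rewrite !entryE ?(ltnW i_n) ?[i + 1]addn1 //; split=> //; exact: E.
Qed.

(** One application of the relation at one place, as in [Move]; its reflexive transitive closure is
    the braid congruence. *)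
Inductive rewrites : word -> word -> Prop :=
| Rewrites p q : rewrites (p ++ [:: true; false; true] ++ q)
                          (p ++ [:: false; true; false] ++ q)
| Rewrites_sym u v : rewrites u v -> rewrites v u.

Lemma rewrites_cong u v : rewrites u v -> braid_cong u v.
Proof.
elim=> [p q|{}u {}v _]; last exact: bc_sym.
by apply: bc_cat; [exact: bc_refl | apply: bc_cat (bc_refl q); exact: bc_rel].
Qed.

Lemma rewrites_cat p q u v : rewrites u v -> rewrites (p ++ u ++ q) (p ++ v ++ q).
Proof.
elim=> [p' q'|{}u {}v _]; last exact: Rewrites_sym.
by have := Rewrites (p ++ p') (q' ++ q); rewrite -!catA.
Qed.

Lemma codes_moves c d u v : rewrites u v -> codes c u -> codes d v ->
  moves (decode c) (decode d).
Proof.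
rewrite /codes => uv -> ->; elim: uv => {c d u v} [p q|u v _ [uv [j [ju uvj E]]]].
  split; first by rewrite !size_map !size_cat.
  exists (size p); split.
  - by rewrite size_map !size_cat ltn_add2l.
  - left; rewrite /relation_at !map_cat !nth_cat !size_map !ltnNge !leq_addr leqnn /=.
    by rewrite subnn !addKn.
  move=> i _ H; rewrite !map_cat !nth_cat !size_map.
  case: H => [-> //|H]; rewrite ltnNge (leq_trans (leq_addr 2 _) (ltnW H)) /=.
  by rewrite ltnNge leq_subRL ?(leq_trans (leq_addr 2 _) (ltnW H)) // addnS H.
split; first by [].
by exists j; split; rewrite -?uv //; [tauto | move=> i iu ij; rewrite E].
Qed.

Lemma moves_codes c d u : codes c u -> moves (decode c) (decode d) ->
  exists2 v, codes d v & rewrites u v.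
Proof.
move=> cu [cd [j [jc cdj E]]].
have szu : size u = size (decode c) by rewrite cu size_map.
have split3 (s : seq nat) : j + 2 < size s -> s = take j s ++
    [:: nth 0 s j; nth 0 s (j + 1); nth 0 s (j + 2)] ++ drop (j + 3) s.
  move=> js; rewrite -{1}(cat_take_drop j s) (drop_nth 0) ?(drop_nth 0 (n := j.+1)) ?(drop_nth 0 (n := j.+2)); try lia.
  by rewrite addn1 addn2 addn3.
have takeE : take j (decode d) = take j (decode c).
  apply: (@eq_from_nth _ 0); rewrite !size_take -cd // => i ij.
  have {}ij : i < j by move: ij; case: ifP; lia.
  by rewrite !nth_take // E; [ | lia | left].
have dropE : drop (j + 3) (decode d) = drop (j + 3) (decode c).
  apply: (@eq_from_nth _ 0); rewrite !size_drop -cd // => i ij.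
  by rewrite !nth_drop E; [ | lia | right; lia].
have dE := split3 (decode d); have cE := split3 (decode c).
rewrite -cd in dE; rewrite takeE dropE in dE.
have {}dE := dE jc; have {}cE := cE jc.
pose p := take j u; pose q := drop (j + 3) u.
have pE : take j (decode c) = map letter_code p by rewrite cu map_take.
have qE : drop (j + 3) (decode c) = map letter_code q by rewrite cu map_drop.
rewrite {}pE {}qE in dE cE.
case: cdj => [[a1 a2 a3 b1 [b2 b3]]|[b1 b2 b3 a1 [a2 a3]]].
  exists (p ++ [:: false; true; false] ++ q).
    by rewrite /codes dE b1 b2 b3 !map_cat.
  have -> : u = p ++ [:: true; false; true] ++ q; last exact: Rewrites.
  by apply: (inj_map letter_code_inj); rewrite -cu cE a1 a2 a3 !map_cat.
exists (p ++ [:: true; false; true] ++ q).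
  by rewrite /codes dE b1 b2 b3 !map_cat.
have -> : u = p ++ [:: false; true; false] ++ q; last by apply/Rewrites_sym/Rewrites.
by apply: (inj_map letter_code_inj); rewrite -cu cE a1 a2 a3 !map_cat.
Qed.

Inductive rewrites_star : word -> word -> Prop :=
| rewrites0 u : rewrites_star u u
| rewritesS u v w : rewrites_star u v -> rewrites v w -> rewrites_star u w.

Lemma rewrites_star_trans u v w :
  rewrites_star u v -> rewrites_star v w -> rewrites_star u w.
Proof. by move=> uv vw; elim: vw uv => {v w} // v w x _ IH wx /IH /rewritesS; apply. Qed.

Lemma rewrites_star_sym u v : rewrites_star u v -> rewrites_star v u.
Proof.
elim=> {u v} [u|u v w _ vu vw]; first exact: rewrites0.
by apply: rewrites_star_trans vu; exact: rewritesS (rewrites0 _) (Rewrites_sym vw).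
Qed.

Lemma rewrites_star_cat p q u v :
  rewrites_star u v -> rewrites_star (p ++ u ++ q) (p ++ v ++ q).
Proof.
elim=> {u v} [u|u v w _ IH vw]; first exact: rewrites0.
exact: rewritesS IH (rewrites_cat p q vw).
Qed.

Lemma cong_rewrites_star u v : braid_cong u v -> rewrites_star u v.
Proof.
elim=> {u v} [|u|u v _|u v w _ uv _|u u' v v' _ uu' _ vv'].
- exact: rewritesS (rewrites0 _) (Rewrites [::] [::]).
- exact: rewrites0.
- exact: rewrites_star_sym.
- exact: rewrites_star_trans.
have := rewrites_star_cat u [::] vv'; rewrite !cats0.
by move/rewrites_star_trans; apply; exact: (rewrites_star_cat [::] v' uu').
Qed.

Lemma chain_codes c d u : codes c u ->
  chain c d (fun x y => x = y \/ moves x y) <->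
  exists2 v, codes d v & braid_cong u v.
Proof.
move=> cu; split=> [[n [f [f0 <- E]]]|[v dv /cong_rewrites_star uv]].
  elim: n E => [|n IH] E; first by rewrite f0; exists u => //; exact: bc_refl.
  have [i i_n|v fv uv] := IH; first by apply: E; exact: ltnW.
  have [EQ|/(moves_codes fv)[w fw vw]] := E n (ltnSn n).
    by exists v; rewrite // /codes -EQ.
  by exists w => //; exact: bc_trans uv (rewrites_cong vw).
elim: uv c d cu dv => {u v} [u|u v w _ IH vw] c d cu dw.
  (* A word has several codes, so passing from [c] to [d] takes one step even when the words are
     equal. *)
  exists 1, (fun i => if i is 0 then c else d); split=> // -[] // _.
  by left; rewrite cu dw.
have [n [f [f0 fn E]]] := IH c (encode (map letter_code v)) cu (encodeK _).
exists n.+1, (fun i => if i == n.+1 then d else f i); split=> //.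
  by rewrite eqxx.
move=> i; rewrite ltnS leq_eqVlt eqSS => /orP[/eqP ->|i_n].
  rewrite eqxx (ltn_eqF (ltnSn n)) fn; right.
  by apply: codes_moves vw _ dw; exact: encodeK.
by rewrite !ltn_eqF ?(ltnW i_n) //; [exact: E | exact: leqW].
Qed.

Lemma sat_same_braid_codes u v d rho vu vv wu :
  denotes u d rho vu -> denotes v d rho vv -> codes vu wu ->
  sat (SameBraid u v) d rho (exists2 wv, codes vv wv & braid_cong wu wv).
Proof.
by move=> uv v_v cu; apply: sat_iff (sat_same_braid uv v_v); exact: chain_codes.
Qed.

(** * Blocks, normal words and reduction steps in arithmetic *)

Lemma sumn_drop s k : k < size s ->
  sumn (drop k s) = sumn (drop k.+1 s) + nth 0 s k.
Proof. by move=> ks; rewrite (drop_nth 0 ks) /= addnC. Qed.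

Lemma size_word_of_blocksE s : size (word_of_blocks s) = sumn s.
Proof.
elim/last_ind: s => // s x IH.
by rewrite word_of_blocks_rcons size_cat size_nseq IH sumn_rcons addnC.
Qed.

Lemma nth_word_of_blocks s k i : k < size s ->
  sumn (drop k.+1 s) <= i < sumn (drop k s) ->
  nth true (word_of_blocks s) i = sigma k.+1.
Proof.
elim/last_ind: s k i => // s x IH k i; rewrite size_rcons ltnS word_of_blocks_rcons.
rewrite leq_eqVlt => /orP[/eqP ->|ks].
  rewrite [drop (size s).+1 _]drop_oversize ?size_rcons // drop_rcons // drop_size /=.
  by rewrite addn0 => ix; rewrite nth_cat size_nseq ix nth_nseq ix.
rewrite !drop_rcons ?(ltnW ks) // !sumn_rcons nth_cat size_nseq => /andP[li ui].
rewrite ifF; last by lia.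
by apply: IH => //; lia.
Qed.

Lemma block_at s i : i < sumn s ->
  exists2 k, k < size s & sumn (drop k.+1 s) <= i < sumn (drop k s).
Proof.
move=> i_s; have := leqnn (size s).
have : i < sumn (drop 0 s) by rewrite drop0.
suff H n k : n = size s - k -> i < sumn (drop k s) -> k <= size s ->
    exists2 k, k < size s & sumn (drop k.+1 s) <= i < sumn (drop k s).
  by move=> i0 _; exact: (H (size s) 0 (esym (subn0 _)) i0).
elim: n k => [|n IH] k nE ik ks.
  by move: ik; rewrite drop_oversize //; lia.
case: (leqP (sumn (drop k.+1 s)) i) => ik1; last by apply: (IH k.+1) => //; lia.
by exists k; [lia | rewrite ik1].
Qed.

Lemma sat_word_of_blocks w e d rho vw ve :
  denotes w d rho vw -> denotes e d rho ve ->
  sat (WordOfBlocks w e) d rho (codes vw (word_of_blocks (decode ve))).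
Proof.
move=> wv ev; apply: sat_iff; last by rewrite /WordOfBlocks; saturate.
rewrite /= -[1 + 1]/2; set s := decode ve.
have letterE k a : a = 1 /\ ~~ odd k \/ a = 2 /\ odd k <-> a = letter_code (sigma k.+1).
  rewrite /sigma /letter_code /=; case: (odd k) => /=; intuition congruence.
split=> [[l [p [f [[[[[wl ep] fp] f0] fl] E]]]]|cw].
  have ps : p = size s by rewrite size_decode.
  (* The entries of [f] are forced to be the total lengths of the blocks of index at least [k].
     Positions are counted from the left and blocks from the right, so the induction goes down from
     the entry 0 at [p]. *)
  have fE j : j <= p -> entry f (p - j) = sumn (drop (p - j) s).
    elim: j => [|j IH] jp; first by rewrite subn0 fl drop_oversize ?ps.
    have k_p : p - j.+1 < p by lia.
    have [x [y [z [[[[fx ey] fz] zE] _]]]] := E _ k_p.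
    rewrite sumn_drop -?ps // fz zE -fx -ey nth_decode ?ep // subnSK // -IH ?(ltnW jp) //.
    by congr (entry _ _ + _); lia.
  have {}fE k : k <= p -> entry f k = sumn (drop k s).
    by move=> kp; have := fE (p - k) (leq_subr _ _); rewrite subKn.
  have sl : sumn s = l by rewrite -f0 fE // drop0.
  apply: decode_eq; rewrite size_map size_word_of_blocksE sl // => i il.
  rewrite (nth_map true) ?size_word_of_blocksE ?sl //.
  have [|k ks /andP[xi iz]] := @block_at s i; first by rewrite sl.
  rewrite (nth_word_of_blocks ks) ?xi //; apply/letterE.
  rewrite -ps in ks; have [x [y [z [[[[fx ey] fz] _] H]]]] := E k ks.
  have [||[h [kh ->]]|[h [kh ->]]] := H i.
  - by rewrite -fz fE // ltnW.
  - by rewrite -fx [k + 1]addn1 fE // addn1 ltnS.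
  - by left; rewrite kh addnn odd_double.
  - by right; rewrite kh addnn addn1 /= odd_double.
exists (sumn s), (size s), (encode (mkseq (fun k => sumn (drop k s)) (size s + 1))).
have fE k : k <= size s ->
    entry (encode (mkseq (fun k => sumn (drop k s)) (size s + 1))) k = sumn (drop k s).
  by move=> ks; rewrite entry_encode_mkseq // addn1 ltnS.
rewrite len_encode_mkseq !fE // drop0 drop_size (codes_len cw).
split=> [|k ks]; first by rewrite size_word_of_blocksE size_decode.
exists (sumn (drop k.+1 s)), (nth 0 s k), (sumn (drop k s)).
have ke : k < len ve by rewrite -size_decode.
rewrite fE ?[k + 1]addn1 // fE ?(ltnW ks) // (sumn_drop ks) -nth_decode //; split=> //.
move=> i iz xi.
have iw : i < sumn s.
  rewrite -[s in sumn s](cat_take_drop k) sumn_cat; rewrite (sumn_drop ks).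
  exact: ltn_addl.
have wi : entry vw i = letter_code (sigma k.+1).
  rewrite (codes_entry cw) ?size_word_of_blocksE //.
  rewrite (nth_word_of_blocks ks) // (sumn_drop ks) iz andbT.
  by move: xi; rewrite addn1 ltnS => ->.
case/letterE: wi => -[wi ok]; [left | right]; exists k./2; split=> //;
  rewrite addnn ?addn1 -{1}(odd_double_half k) ?ok ?(negbTE ok) //.
Qed.

Ltac sat_leaf ::= first [refine (sat_len _ _) | refine (sat_entry _ _ _)
  | refine (sat_word_of_blocks _ _)].

Lemma sat_emin k m d rho vk vm : denotes k d rho vk -> denotes m d rho vm ->
  sat (Emin k m) d rho (vm = emin vk.+1).
Proof.
move=> kv mv; apply: sat_iff; last by rewrite /Emin; saturate.
by case: vk kv => [|[|?]] _ /=; lia.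
Qed.
Ltac sat_leaf ::= first [refine (sat_len _ _) | refine (sat_entry _ _ _)
  | refine (sat_word_of_blocks _ _) | refine (sat_emin _ _)].

Lemma sat_phi_normal w e d rho vw ve :
  denotes w d rho vw -> denotes e d rho ve ->
  sat (PhiNormal w e) d rho
    (exists2 u, codes vw u & phi_normal u (decode ve)).
Proof.
move=> wv ev; apply: sat_iff; last first.
  rewrite /PhiNormal /BlockDecomposition; saturate.
set s := decode ve.
have es k : k < len ve -> entry ve k = nth 0 s k by move=> ks; rewrite nth_decode.
have ss : size s = len ve by rewrite size_decode.
clearbody s.
split=> [[[ws [_ [[<- p0] pos]]] [_ [<- me]]]|[u wu /phi_normalE[uE s0 /(normal_expsP s0)[ls me]]]].
  have s0 : s <> [::] by move=> s0; rewrite -ss s0 in p0.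
  exists (word_of_blocks s) => //; apply/phi_normalE; split=> //.
  apply/(normal_expsP s0); split=> [|i i_s].
    have p1 : (len ve).-1 < len ve by rewrite prednK.
    have [|y [ye y0]] := pos _ p1; first by right; rewrite addn1 prednK.
    by rewrite -nth_last ss -es // ye.
  have iv : i < len ve by rewrite -ss ltnW.
  have [|y [m [[ye ->]]]] := me i iv; first by rewrite addn1 -ss.
  by rewrite addn1 ltnS -es // ye.
have p0 : 0 < len ve by rewrite -ss; case: (s) s0.
rewrite -uE; split; last first.
  exists (len ve); split=> // k kv; rewrite addn1 => k1.
  by exists (entry ve k), (emin k.+1); rewrite addn1 ltnS es // me // ss.
split=> //; exists (len ve); split=> // k kv k0; exists (entry ve k); split=> //.
rewrite es //; case: (ltngtP k.+1 (len ve)) => [k1|/leq_gtF|kE].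
- case: k0 => [k0|kE]; last by move: k1; rewrite -kE addn1 ltnn.
  apply: leq_trans (me k _); rewrite ?ss //.
  by case: k k0 {kv k1} => // -[].
- by rewrite ltnS kv.
by rewrite -[k]/(k.+1.-1) kE -ss nth_last.
Qed.

Lemma sat_critical e r d rho ve vr :
  denotes e d rho ve -> denotes r d rho vr ->
  sat (Critical e r) d rho (decode ve <> [::] /\ critical (decode ve) = vr.+1).
Proof.
move=> ev rv; apply: sat_iff; last first.
  rewrite /Critical; saturate.
set s := decode ve.
have es k : k < len ve -> entry ve k = nth 0 s k by move=> ks; rewrite nth_decode.
have ss : size s = len ve by rewrite size_decode.
clearbody s; split=> [[_ [[[<- r_p] below_r] at_r]]|[s0 rE]].
  split; first by move=> s0; rewrite -ss s0 in r_p.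
  apply: critical_unique; first by rewrite ss.
    move=> [|k] //; rewrite ltnS => kr.
    have [y [m [[<- ->] /negP]]] := below_r k kr.
    by rewrite -leqNgt es //; exact: ltn_trans r_p.
  case: at_r => [rE|[y [m [[<- ->] em]]]]; first by left; rewrite ss -rE addn1.
  by right; rewrite /block /= -es.
have [/andP[_ cs] below_c at_c] := criticalP s0; rewrite rE in cs below_c at_c.
exists (len ve); rewrite -ss; split; first split=> //.
  move=> k kr; exists (entry ve k), (emin k.+1); split=> //; apply/negP.
  by rewrite -leqNgt es -?ss ?(ltn_trans kr) //; apply: (below_c k.+1).
case: at_c => [<-|em]; first by left; rewrite addn1.
by right; exists (entry ve vr), (emin vr.+1); split=> //; rewrite es -?ss.
Qed.
Ltac sat_leaf ::= first [refine (sat_len _ _) | refine (sat_entry _ _ _)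
  | refine (sat_critical _ _)].

Lemma sat_reduce_blocks e t e' d rho ve vt ve' :
  denotes e d rho ve -> denotes t d rho vt -> denotes e' d rho ve' ->
  decode ve <> [::] -> normal_exps (decode ve) ->
  sat (ReduceBlocks e t e') d rho (decode ve' = reduce_blocks (decode ve) vt).
Proof.
move=> ev tv ev' s0 ne; apply: sat_iff; last first.
  rewrite /ReduceBlocks; saturate.
set s := decode ve in s0 ne *.
have es k : k < len ve -> entry ve k = nth 0 s k by move=> ks; rewrite nth_decode.
have ss : size s = len ve by rewrite size_decode.
clearbody s.
(* Positivity makes the equation [y = z + 1] of the formula agree with the predecessor in
   [reduce_blocks]. *)
have crit_pos : 0 < nth 0 s (critical s).-1.
  have [/andP[c0 cs] _ [cE|]] := criticalP s0; last exact: leq_ltn_trans.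
  by rewrite cE nth_last; case/(normal_expsP s0): ne.
split=> [[_ [r [[[<- ps] [_ rE]] E]]]|E].
  apply: decode_eq; rewrite size_reduce_blocks ss // => i i_s.
  rewrite nth_reduce_blocks ?ss // rE !eqSS -es //.
  have [y [z [[<- <-]]]] := E i i_s.
  case: eqP => [-> [[[_ ->]|[]]|[[]//]]|ir]; [by rewrite addn1 | lia | ].
  case: eqP => [<- [[[]//|[_ ->]]|[[_ []]]]|ir' [[[]//|[]]|[_ ->]]] //; lia.
exists (len ve), (critical s).-1.
have [/andP[c0 cs] _ _] := criticalP s0.
have ss' : len ve' = len ve by rewrite -size_decode E size_reduce_blocks.
rewrite ss' prednK //; split=> // k ks; exists (entry ve k), (entry ve' k); split=> //.
rewrite -[entry ve' k]nth_decode ?ss' // E nth_reduce_blocks ?ss // es //.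
case: eqP => [kc|kc]; first by left; left; rewrite -kc /= addn1 prednK // -[k]/(k.+1.-1) kc.
case: eqP => [kc'|kc']; first by left; right; rewrite -kc' addn1.
by right; split=> //; split; lia.
Qed.

(** The formulas for reduction and for equality of braids are interpreted only for normal exponents
    and for codes of words; the earlier conjuncts of [BraidStep] guarantee this. *)
Lemma sat_and_dep A B d rho P Q :
  sat A d rho P -> (P -> sat B d rho Q) -> sat (fand A B) d rho (P /\ Q).
Proof.
move=> AP BQ; have [p|np] := EM P; first exact: sat_and (BQ p).
by rewrite /sat /=; split=> [H|[/np]//]; case: H => /AP /np.
Qed.

Definition braid_step_code (u t v : nat) : Prop :=
  exists w e e' w',
    ((((chain u w (fun x y => x = y \/ moves x y) /\
     (exists2 ww, codes w ww & phi_normal ww (decode e))) /\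
     decode e' = reduce_blocks (decode e) t) /\
     codes w' (word_of_blocks (decode e'))) /\
     exists2 wv, codes v wv & braid_cong (word_of_blocks (decode e')) wv).

Lemma sat_braid_step u t v d rho vu vt vv :
  denotes u d rho vu -> denotes t d rho vt -> denotes v d rho vv ->
  sat (BraidStep u t v) d rho (braid_step_code vu vt vv).
Proof.
move=> uv tv v_v; rewrite /BraidStep /braid_step_code.
refine (sat_ex _) => w; refine (sat_ex _) => e.
refine (sat_ex _) => e'; refine (sat_ex _) => w'.
apply: sat_and_dep => [|[_ w'c]]; last by apply: sat_same_braid_codes w'c; denote.
apply: sat_and; last by apply: sat_word_of_blocks; denote.
apply: sat_and_dep => [|[_ [ww _ /phi_normalE[_ e0 ne]]]].
  apply: sat_and; last by apply: sat_phi_normal; denote.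
  by apply: sat_same_braid; denote.
by apply: sat_reduce_blocks e0 ne; denote.
Qed.

Lemma braid_step_codeP u t v wu : codes u wu ->
  braid_step_code u t v <->
  exists2 wv, codes v wv & braid_step (braid_of wu) t (braid_of wv).
Proof.
move=> cu; split.
  move=> [w [e [e' [w' [[[[uw [w2 cw2 ne]] eE] _] [wv cv vw]]]]]].
  have [w1 cw uw1] := proj1 (chain_codes _ cu) uw.
  exists wv => //; exists w1, (decode e); split; first exact/braid_ofP.
    by rewrite (codes_inj cw cw2).
  by apply/braid_ofP; rewrite -eE; exact: bc_sym.
move=> [wv cv [w1 [e [/braid_ofP uw1 ne /braid_ofP vE]]]].
exists (encode (map letter_code w1)), (encode e), (encode (reduce_blocks e t)).
exists (encode (map letter_code (word_of_blocks (reduce_blocks e t)))).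
rewrite !encodeK; split; last by exists wv => //; exact: bc_sym.
split; last exact: encodeK.
split=> //; split; last by exists w1; rewrite // /codes encodeK.
by apply/(chain_codes _ cu); exists w1 => //; exact: encodeK.
Qed.
Ltac sat_leaf ::= first [refine (sat_len _ _) | refine (sat_entry _ _ _)
  | refine (sat_same_braid _ _) | refine (sat_braid_step _ _ _)].

Definition word_of_code (c : nat) : word := [seq x == 1 | x <- decode c].

Lemma codesK c w : codes c w -> word_of_code c = w.
Proof.
by rewrite /codes /word_of_code => ->; rewrite -map_comp map_id_in // => -[].
Qed.

Lemma sat_g3_stops_at u n d rho vu vn wu :
  denotes u d rho vu -> denotes n d rho vn -> codes vu wu ->
  sat (G3StopsAt u n) d rho (G3_stops_at (braid_of wu) vn).
Proof.
move=> uv nv cu; apply: sat_iff; last by rewrite /G3StopsAt /TrivialBraid; saturate.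
split.
  move=> [s [[[sn s0] step] [_ [<- [v [v0 uv0]]]]]].
  (* The formula does not say that the entries of [s] code words; they inherit this from [u] through
     the successive steps. *)
  have codes_s t : t <= vn -> codes (entry s t) (word_of_code (entry s t)).
    elim: t => [|t IH] tn; first by rewrite s0 (codesK cu).
    have [x [y [[sx sy]]]] := step t tn; rewrite -sx -sy addn1.
    case/(braid_step_codeP _ _ (IH (ltnW tn))) => w cw _.
    by rewrite (codesK cw).
  exists (fun t => braid_of (word_of_code (entry s t))); split.
  - by rewrite s0 (codesK cu).
  - move=> t tn; have [x [y [[sx sy]]]] := step t tn; rewrite -sx -sy !addn1.
    case/(braid_step_codeP _ _ (codes_s t (ltnW tn))) => w cw bs.
    rewrite (codesK cw); split=> //.
    case: bs => w' [e [-> /phi_normalE[-> e0 ne] _]] /braid_ofP /braid_cong_size E.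
    by have := size_word_of_blocks ne e0; rewrite E.
  have [w cw /bc_sym] := proj1 (chain_codes _ (codes_s vn (leqnn vn))) uv0.
  have -> : w = [::] by apply: size0nil; rewrite -(codes_len cw).
  by move=> /bc_sym /braid_ofP.
move=> [b [b0 bS bn]].
(* The initial entry must be [vu] itself, since another code of the same word would not satisfy the
   formula. *)
pose f t := if t is 0 then vu else encode (map letter_code (repr (b t))).
have fw t : exists2 w, codes (f t) w & braid_of w = b t.
  case: t => [|t]; first by exists wu.
  by exists (repr (b t.+1)); [exact: encodeK | rewrite /braid_of reprK].
exists (encode (mkseq f (vn + 1))).
have fE t : t <= vn -> entry (encode (mkseq f (vn + 1))) t = f t.
  by move=> tn; rewrite entry_encode_mkseq // addn1 ltnS.
rewrite len_encode_mkseq fE //; split; first split=> //.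
  move=> t tn; exists (f t), (f t.+1); rewrite [in t + 1]addn1 !fE ?(ltnW tn) //.
  split=> //; have [w cw wb] := fw t; have [w' cw' wb'] := fw t.+1.
  apply/(braid_step_codeP _ _ cw); exists w' => //; rewrite wb wb'.
  by have [] := bS t tn.
exists (f vn); rewrite fE //; split=> //; have [w cw wb] := fw vn.
exists (encode [::]); rewrite len_encode; split=> //.
apply/(chain_codes _ cw); exists [::]; first exact: encodeK.
by apply/braid_ofP; rewrite wb bn.
Qed.

Lemma g3_finite_sat rho d :
  sat (ALL u, Word u ==> (EX n, G3StopsAt u n))%fm d rho
    (forall b : braid, G3_finite b).
Proof.
apply: (@sat_iff _ _ _ (forall c, (exists w, codes c w) ->
    exists n, G3_stops_at (braid_of (word_of_code c)) n)).
  split=> [H b|H c _]; last exact: H.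
  elim/braid_ind: b => w.
  have cw : codes (encode (map letter_code w)) w := encodeK _.
  by have := H _ (ex_intro _ w cw); rewrite (codesK cw).
refine (sat_all _) => c.
have [[w cw]|nw] := EM (exists w, codes c w).
  rewrite (codesK cw); apply: sat_imp; first by apply: sat_word; denote.
  by refine (sat_ex _) => n; apply: sat_g3_stops_at cw; denote.
have := @sat_word (bvar d) d.+1 (scons c rho) c (denotes_bvar _ _ _).
by rewrite /sat /= => W; split=> [_ /nw//|_ /W/nw].
Qed.

(** * Growth *)

Section IterMono.
Variable F : nat -> nat.
Hypothesis F_mono : {homo F : x y / x <= y}.
Hypothesis F_ge : forall x, x <= F x.

Lemma iter_homo n : {homo iter n F : x y / x <= y}.
Proof. by elim: n => //= n IH x y /IH /F_mono. Qed.

Lemma iter_ge n x : x <= iter n F x.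
Proof. by elim: n => //= n IH; exact: leq_trans IH (F_ge _). Qed.

Lemma iter_leq m n x : m <= n -> iter m F x <= iter n F x.
Proof. by move=> /subnK <-; rewrite iterD; exact: iter_ge. Qed.
End IterMono.

Lemma wait_spec r : (forall t, t < wait r t) /\ {homo wait r : x y / x < y}.
Proof.
elim: r => [|r [gt ltW]] /=; first by split=> [t|x y]; rewrite ?ltnS.
have ge t : t <= wait r t by exact: ltnW.
have mono : {homo wait r : x y / x <= y}.
  move=> x y; rewrite leq_eqVlt => /orP[/eqP -> //|xy]; exact: ltnW (ltW _ _ xy).
split=> [t|x y xy]; first exact: (iter_ge ge t.+1 t.+1).
apply: leq_ltn_trans (_ : iter x.+1 (wait r) y.+1 < _); first by apply: (iter_homo mono); exact: ltnW.
apply: leq_trans (gt _) _; exact: (@iter_leq _ ge x.+2 y.+1).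
Qed.

Arguments wait : simpl never.

Lemma wait_gt r t : t < wait r t. Proof. exact: (wait_spec r).1. Qed.
Lemma wait_ge r t : t <= wait r t. Proof. exact: ltnW (wait_gt r t). Qed.

Lemma wait_mono r x y : x <= y -> wait r x <= wait r y.
Proof.
rewrite leq_eqVlt => /orP[/eqP -> //|xy].
exact: ltnW ((wait_spec r).2 _ _ xy).
Qed.

Lemma wait_addr r t d : wait r t + d <= wait r (t + d).
Proof.
elim: d => [|d IH]; first by rewrite !addn0.
rewrite !addnS; apply: leq_ltn_trans IH _; exact: (wait_spec r).2.
Qed.

(** Trading the argument for the index is what brings a fixed row under the diagonal [wait q 0]. *)
Lemma wait_shift r j t : wait r (t + j) <= wait (r + j) t.
Proof.
elim: j t => [|j IH] t; first by rewrite !addn0.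
rewrite !addnS -addSn; apply: leq_trans (IH _) _.
exact: (@iter_leq _ (wait_ge _) 1).
Qed.

Lemma wait_monol r s t : r <= s -> wait r t <= wait s t.
Proof.
move=> /subnK <-; rewrite addnC; apply: leq_trans (wait_shift _ _ _).
by apply: wait_mono; exact: leq_addr.
Qed.

Lemma iter_wait_le r n t : n <= t.+1 -> iter n (wait r) t <= wait r.+1 t.
Proof.
move=> nt; apply: leq_trans (iter_leq (wait_ge r) _ nt).
by apply: (@iter_homo _ (@wait_mono _)).
Qed.

Lemma iter_wait_addr r n t d : iter n (wait r) t + d <= iter n (wait r) (t + d).
Proof.
elim: n => //= n IH; apply: leq_trans (wait_addr _ _ _) _; exact: wait_mono.
Qed.

Lemma wait1E t : wait 1 t = t.+1 + t.+1.
Proof.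
have H n : iter n (fun s => s.+1) t.+1 = n + t.+1 by elim: n => //= n ->.
exact: H.
Qed.

(** Domination by one row of an Ackermann-like hierarchy. It replaces primitive recursiveness, of
    which only closure under sum, product, exponentiation, composition and iteration matters
    here. *)
Definition tame (f : nat -> nat) : Prop :=
  exists r c, forall n, f n <= wait r (n + c).

Lemma tame_le f g : (forall n, f n <= g n) -> tame g -> tame f.
Proof.
by move=> fg [r [c H]]; exists r, c => n; exact: leq_trans (fg n) (H n).
Qed.

Lemma tame_id : tame id.
Proof. by exists 0, 0 => n; rewrite addn0 leqW. Qed.

Lemma tame_const c : tame (fun=> c).
Proof. by exists 0, c => n; rewrite leqW // leq_addl. Qed.

Lemma tame_comp f g : tame f -> tame g -> tame (f \o g).
Proof.
(* Row [k.+1] absorbs two applications of row [k] at positive arguments, whence the extra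
   successor. *)
move=> [r [c fr]] [s [d gs]]; exists (maxn r s).+1, (d + c).+1 => n /=.
apply: leq_trans (fr _) _.
apply: leq_trans (wait_mono _ (leq_add (gs n) (leqnn c))) _.
apply: leq_trans (wait_mono _ (wait_addr _ _ _)) _.
apply: leq_trans (iter_wait_le _ (n := 2) _); last by rewrite addnS.
rewrite /=; apply: leq_trans (wait_monol _ (leq_maxl r s)) _.
apply/wait_mono; apply: leq_trans (wait_monol _ (leq_maxr r s)) _.
by apply/wait_mono; rewrite addnS addnA.
Qed.

Lemma tame_add f g : tame f -> tame g -> tame (fun n => f n + g n).
Proof.
move=> [r [c fr]] [s [d gs]].
pose h n := wait (maxn r s) (n + (c + d)).
apply: (@tame_le _ (wait 1 \o h)) => [n|]; last first.
  apply: tame_comp; first by exists 1, 0 => n; rewrite addn0.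
  by exists (maxn r s), (c + d).
rewrite -[(_ \o _) n]/(wait 1 (h n)) wait1E; apply: leq_add; apply: leqW.
  apply: leq_trans (fr n) (leq_trans (wait_monol _ (leq_maxl r s)) _).
  by apply: wait_mono; rewrite leq_add2l leq_addr.
apply: leq_trans (gs n) (leq_trans (wait_monol _ (leq_maxr r s)) _).
by apply: wait_mono; rewrite leq_add2l leq_addl.
Qed.

Lemma tame_exp2 : tame (expn 2).
Proof.
exists 2, 0 => n; rewrite addn0.
suff H m t : 2 ^ m <= iter m (wait 1) t.+1.
  by apply: leq_trans (H n n) _; exact: (iter_leq (wait_ge 1)).
elim: m => // m IH; rewrite iterS -[wait 1 _]/(wait 1 _) wait1E expnS mul2n -addnn.
by apply: leq_add; exact: leqW.
Qed.

Lemma tame_mul f g : tame f -> tame g -> tame (fun n => f n * g n).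
Proof.
move=> tf tg; apply: tame_le (tame_comp tame_exp2 (tame_add tf tg)) => n.
by rewrite /= expnD leq_mul // ltnW // ltn_expl.
Qed.

Lemma leq_expl m n e : m <= n -> m ^ e <= n ^ e.
Proof. by case: e => // e mn; rewrite leq_exp2r. Qed.

Lemma tame_exp f g : tame f -> tame g -> tame (fun n => f n ^ g n).
Proof.
move=> tf tg; apply: tame_le (tame_comp tame_exp2 (tame_mul tf tg)) => n.
by rewrite /= expnM leq_expl // ltnW // ltn_expl.
Qed.

Lemma tame_fact : tame factorial.
Proof.
apply: tame_le (tame_exp tame_id tame_id) => n.
elim: n => // n IH; rewrite factS expnS leq_mul2l /=.
by apply: leq_trans IH _; exact: leq_expl.
Qed.

Lemma tame_iter f g h : tame f -> tame g -> tame h ->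
  tame (fun n => iter (h n) f (g n)).
Proof.
move=> [r [c fr]] tg th.
(* Each of the [h n] iterations shifts the argument by [c], and all shifts are moved into the
   initial argument; the last summand makes this argument at least the number of iterations. *)
pose y n := g n + h n * c + h n.
apply: (@tame_le _ (wait r.+1 \o y)); last first.
  apply: tame_comp; first by exists r.+1, 0 => n; rewrite addn0.
  by do 2![apply: tame_add => //]; apply: tame_mul => //; exact: tame_const.
move=> n; rewrite -[(_ \o _) n]/(wait r.+1 (y n)); apply: leq_trans (iter_wait_le (n := h n) _ _); last first.
  by rewrite leqW // leq_addl.
apply: leq_trans (_ : iter (h n) (wait r) (g n + h n * c) <= _); last first.
  by apply: (@iter_homo _ (@wait_mono _)); exact: leq_addr.
elim: (h n) => [|k IH] /=; first by rewrite addn0.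
apply: leq_trans (fr _) (wait_mono _ _).
apply: leq_trans (leq_add IH (leqnn c)) _.
apply: leq_trans (iter_wait_addr _ _ _ _) _.
by rewrite -addnA mulSn [c + _]addnC.
Qed.

Lemma tame_lt_wait f : tame f -> exists q, f q <= wait q 0.
Proof.
(* With [q = r.+2 + j] the argument [q + c] is [j + j], which is below [wait 1 j]. Two applications
   of row [r.+1] then bound [f q] by [wait r.+2 j], and [j] is finally moved into the index. *)
move=> [r [c fr]]; set j := (r + c + 2).
exists (r.+2 + j); apply: leq_trans (fr _) _.
apply: leq_trans (wait_shift _ _ _); rewrite add0n.
apply: leq_trans (_ : wait r (wait 1 j) <= _).
  by apply: wait_mono; rewrite wait1E /j; lia.
apply: leq_trans (iter_wait_le _ (n := 2) _); last by rewrite /j; lia.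
apply: leq_trans (_ : wait r.+1 (wait 1 j) <= _); first exact: wait_monol.
by apply: wait_mono; exact: wait_monol.
Qed.

(** * Gaps without least witnesses *)


(** The set of indices having a witness below [x m] increases with [m], and can do so strictly at
    most [#|J|] times. *)
Lemma stationary_interval (J : finType) (Q : J -> nat -> Prop) (x : nat -> nat) :
  (forall m, x m <= x m.+1) ->
  exists2 m, m <= #|J| & forall j,
    (exists2 y, y < x m.+1 & Q j y) -> exists2 y, y < x m & Q j y.
Proof.
move=> x_mono; pose A m := [set j | `[< exists2 y, y < x m & Q j y >]].
have [[m mJ AA]|noA] := EM (exists2 m, m <= #|J| & A m.+1 \subset A m).
  exists m => // j Qj; have := subsetP AA j; rewrite !inE.
  by move=> H; apply/asboolP/H/asboolP.
have card_A m : m <= #|J|.+1 -> m <= #|A m|.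
  elim: m => // m IH mJ; apply: leq_ltn_trans (IH (ltnW mJ)) _.
  apply: proper_card; rewrite properE; apply/andP; split.
    apply/subsetP => j; rewrite !inE => /asboolP[y yx Qy]; apply/asboolP.
    by exists y => //; exact: leq_trans yx (x_mono m).
  by apply/negP => AA; apply: noA; exists m.
by have := leq_trans (card_A _ (leqnn _)) (max_card _); rewrite ltnn.
Qed.

Lemma teval_below n r r' t : tbelow n t -> (forall i, i < n -> r i = r' i) ->
  teval r t = teval r' t.
Proof.
by move=> nt rr; elim: t nt => //= a IHa b IHb /andP[/IHa -> /IHb ->].
Qed.

Lemma holds_below n r r' A : below n A -> (forall i, i < n -> r i = r' i) ->
  holds r A <-> holds r' A.
Proof.
elim: A n r r' => /= [a b|a b||A IHA B IHB|A IHA] n r r'.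
- by move=> /andP[na nb] rr; rewrite (teval_below na rr) (teval_below nb rr).
- by move=> /andP[na nb] rr; rewrite (teval_below na rr) (teval_below nb rr).
- by [].
- by move=> /andP[nA nB] rr; rewrite (IHA n r r') // (IHB n r r').
move=> nA rr; have H x : holds (scons x r) A <-> holds (scons x r') A.
  by apply: (IHA n.+1) => // -[|i] //= /rr.
by split=> Hx x; apply/H.
Qed.

Lemma tbelow_leq m n t : m <= n -> tbelow m t -> tbelow n t.
Proof.
move=> mn; elim: t => //= [i im|a IHa b IHb|a IHa b IHb].
- exact: leq_trans mn.
- by move=> /andP[/IHa -> /IHb ->].
- by move=> /andP[/IHa -> /IHb ->].
Qed.

Lemma below_leq m n A : m <= n -> below m A -> below n A.
Proof.
elim: A m n => //= [a b|a b|A IHA B IHB|A IHA] m n mn.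
- by move=> /andP[/(tbelow_leq mn) -> /(tbelow_leq mn) ->].
- by move=> /andP[/(tbelow_leq mn) -> /(tbelow_leq mn) ->].
- by move=> /andP[/(IHA _ _ mn) -> /(IHB _ _ mn) ->].
- exact: IHA.
Qed.

Lemma below_exists A : exists n, below n A.
Proof.
have texists t : exists n, tbelow n t.
  elim: t => [i||| a [m ma] b [n nb]| a [m ma] b [n nb]]; try by exists 0.
  - by exists i.+1 => /=.
  - by exists (maxn m n); rewrite /= (tbelow_leq (leq_maxl m n) ma) (tbelow_leq (leq_maxr m n) nb).
  - by exists (maxn m n); rewrite /= (tbelow_leq (leq_maxl m n) ma) (tbelow_leq (leq_maxr m n) nb).
elim: A => [a b|a b||A [m mA] B [n nB]|A [n nA]].
- have [[m ma] [n nb]] := (texists a, texists b).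
  by exists (maxn m n); rewrite /= (tbelow_leq (leq_maxl m n) ma) (tbelow_leq (leq_maxr m n) nb).
- have [[m ma] [n nb]] := (texists a, texists b).
  by exists (maxn m n); rewrite /= (tbelow_leq (leq_maxl m n) ma) (tbelow_leq (leq_maxr m n) nb).
- by exists 0.
- by exists (maxn m n); rewrite /= (below_leq (leq_maxl m n) mA) (below_leq (leq_maxr m n) nB).
by exists n => /=; exact: below_leq nA.
Qed.

(** For the formulas [C] in [L] with parameters below [a], the interval from [a']
    to [b] contains no least witness. *)
Definition indiscernible_gap (L : seq form) (k a a' b : nat) : Prop :=
  forall C, List.In C L -> below k.+1 C ->
  forall rho, (forall i, i < k -> rho i < a) ->
  (exists2 y, y < b & holds (scons y rho) C) ->
  exists2 y, y < a' & holds (scons y rho) C.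

Lemma gap_chain L k n : exists2 f, tame f & forall a, exists s : nat -> nat,
  [/\ s 0 = a, s n <= f a & forall i, i < n ->
      s i * s i <= s i.+1 /\ indiscernible_gap L k (s i) (s i.+1) (s n)].
Proof.
elim: n => [|n [f tf IH]].
  by exists id; [exact: tame_id | move=> a; exists (fun=> a)].
(* The candidates for the second point are the iterates of [g] from [a * a], spaced so that the
   chain given by the induction hypothesis from one candidate ends before the next. As [h a] exceeds
   the number of pairs of a formula of [L] and a valuation below [a] of [k] variables, between two
   of the candidates no pair gets its first witness. *)
pose g x := f x + x + 1.
pose h a := size L * a ^ k + 1.
exists (fun a => iter (h a) g (a * a)).
  apply: tame_iter.
  - apply: tame_add; last exact: tame_const.
    by apply: tame_add => //; exact: tame_id.
  - by apply: tame_mul; exact: tame_id.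
  - apply: tame_add; last exact: tame_const.
    apply: tame_mul; first exact: tame_const.
    by apply: tame_exp; [exact: tame_id | exact: tame_const].
move=> a; pose x m := iter m g (a * a).
have g_gt y : f y < g y by rewrite /g addn1 ltnS leq_addr.
have g_ge y : y <= g y by rewrite /g -addnA [f y + _]addnC -addnA leq_addr.
pose J := ('I_(size L) * {ffun 'I_k -> 'I_a})%type.
pose env (phi : {ffun 'I_k -> 'I_a}) i : nat :=
  if insub i is Some o then phi o else 0.
have [|m mJ gap] := @stationary_interval J
    (fun j y => holds (scons y (env j.2)) (nth Bot (L : seq form) j.1)) x.
  by move=> m; exact: g_ge.
have [s [s0 sn sgap]] := IH (x m).
exists (fun i => if i is i'.+1 then s i' else a); split=> //.
  apply: leq_trans sn (leq_trans (ltnW (g_gt _)) _).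
  apply: (@iter_leq g g_ge m.+1 (h a)); rewrite /h addn1 ltnS.
  by apply: leq_trans mJ _; rewrite card_prod card_ord card_ffun !card_ord.
case=> [|i] i_n; last exact: sgap.
rewrite s0; split; first exact: iter_ge.
move=> C LC kC rho rho_a [y yn Cy].
have [l lL lC] : exists2 l, l < size L & nth Bot L l = C.
  elim: (L) LC => //= D L' IHL [->|/IHL[l lL lC]]; first by exists 0.
  by exists l.+1.
pose phi := [ffun o : 'I_k => Ordinal (rho_a o (ltn_ord o))].
have env_phi y' : holds (scons y' (env phi)) C <-> holds (scons y' rho) C.
  apply: holds_below kC _ => -[|i] //= ik.
  by rewrite /env insubT // ffunE.
have [|y' y'x /=] := gap (Ordinal lL, phi).
  exists y; first by apply: leq_trans yn _; apply: leq_trans sn (ltnW (g_gt _)).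
  by rewrite /= lC; apply/env_phi.
by rewrite lC => /env_phi; exists y'.
Qed.

Lemma tame_code_bound : tame code_bound.
Proof.
have tN : tame id := tame_id.
have t1 := tame_const 1; have tF := tame_fact.
have tN1 : tame (fun n => n + 1) := tame_add tN t1.
pose m n := (1 + (n + 1) * n`!) ^ (n + 1) + n`!.
have tm : tame m.
  apply: tame_add => //; apply: tame_exp => //.
  by apply: tame_add => //; exact: tame_mul.
have tmm : tame (fun n => m n + m n) := tame_add tm tm.
apply: tame_add => //; apply: tame_mul => //; exact: tame_add.
Qed.

Lemma slow_exps_code : exists2 f, tame f & forall q,
  exists2 c, c < f q & codes c (word_of_blocks (slow_exps q)).
Proof.
pose N q := q + q + 6; exists (fun q => code_bound (N q) + 1).
  apply: tame_add; last exact: tame_const.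
  apply: (@tame_comp code_bound N); first exact: tame_code_bound.
  apply: tame_add; last exact: tame_const.
  by apply: tame_add; exact: tame_id.
move=> q; set w := word_of_blocks _.
have emin_le k : emin k <= 2 by case: k => [|[|[|k]]].
have wN : size w < N q.
  have sumE : sumn [seq emin i.+1 | i <- iota 0 q] <= q + q.
    move: emin emin_le => F F2; elim: q 0 {w} => // q IH i /=.
    by have := IH i.+1; have := F2 i.+1; lia.
  rewrite size_word_of_blocksE /slow_exps !sumn_rcons /N.
  by have := emin_le q.+1; lia.
have [||c [cN c0 cE]] := @encode_bounded (size w) (N q)
    (fun i => letter_code (nth true w i)) => //.
  by move=> i _; rewrite /N; case: nth; rewrite /letter_code; lia.
exists c; first by rewrite addn1.
apply: decode_eq; rewrite size_map // => i iw.
by rewrite (nth_map true) // -cE.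
Qed.

Lemma long_gap_chain L k : exists (s : nat -> nat) (q c : nat),
  [/\ codes c (word_of_blocks (slow_exps q)), c < s 0, 2 <= s 0,
      s k <= wait q 0
    & forall i, i < k ->
      s i * s i <= s i.+1 /\ indiscernible_gap L k (s i) (s i.+1) (s k)].
Proof.
have [f tf chain_f] := gap_chain L k k; have [g tg code_g] := slow_exps_code.
(* The list [L] and the length [k] are fixed before [q]. The chain starts at [g q + 2], above the
   code and at least 2. *)
have [q qE] := tame_lt_wait (tame_comp tf (tame_add tg (tame_const 2))).
have [c cg cq] := code_g q; have [s [s0 sk gaps]] := chain_f (g q + 2).
exists s, q, c; split=> //; rewrite ?s0 ?leq_addl //.
- by rewrite (leq_trans cg) // leq_addr.
- exact: leq_trans sk qE.
Qed.

(** * The cut as a model *)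

Lemma teval_tsubst r sg t : teval r (tsubst sg t) = teval (fun i => teval r (sg i)) t.
Proof. by elim: t => //= [a -> b ->|a -> b ->]. Qed.

Fixpoint fresh0 (t : term) : bool :=
  match t with
  | Var i => 0 < i
  | Zero | One => true
  | Add a b | Mul a b => fresh0 a && fresh0 b
  end.

(** Recognizes [x < t] and [x < t /\ _], for [x] the innermost variable. *)
Definition bounds0 (A : form) : bool :=
  match A with
  | Lt (Var 0) t | Imp (Imp (Lt (Var 0) t) _) Bot => fresh0 t
  | _ => false
  end.

(** [persistent true] are Sigma formulas and [persistent false] Pi formulas, up to
    bounded quantifiers. *)
Fixpoint persistent (b : bool) (A : form) : bool :=
  match A with
  | Eq _ _ | Lt _ _ | Bot => true
  | Imp A B => persistent (~~ b) A && persistent b B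
  | All A => persistent b A &&
      (~~ b || if A is Imp P _ then bounds0 P else false)
  end.

Lemma fresh0_tshift t : fresh0 (tshift t).
Proof. by elim: t => //= [a IHa b IHb|a IHa b IHb]; rewrite /tshift /= in IHa IHb *; apply/andP. Qed.

Lemma bounded_persistent b A : bounded A -> persistent b A.
Proof.
move=> bA; elim: bA b => {A} //= [A B _ IHA _ IHB|t A _ IHA|t A _ IHA] b.
- by rewrite IHA IHB.
- by rewrite IHA fresh0_tshift orbT.
- by rewrite IHA fresh0_tshift !orbT.
Qed.

Lemma bounds0P A : bounds0 A -> exists2 t, fresh0 t &
  forall r, holds r A -> r 0 < teval r t.
Proof.
case: A => //= [[] // [|n] // t ft|]; first by exists t.
case=> // -[] // [] // [] // t C [] // ft; exists t => // r /= H.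
by apply: contrapT => nlt; apply: H.
Qed.

Lemma teval_fresh0 t x y r : fresh0 t -> teval (scons x r) t = teval (scons y r) t.
Proof.
by elim: t => //= [[]//|a IHa b IHb|a IHa b IHb] /andP[/IHa -> /IHb ->].
Qed.

Section Model.
Variables (I : Type) (most : (I -> Prop) -> Prop).
Hypothesis most_all : forall P : I -> Prop, (forall p, P p) -> most P.
Hypothesis most_imp : forall P Q : I -> Prop,
  most (fun p => P p -> Q p) -> most P -> most Q.
Hypothesis most_not : forall P : I -> Prop, most (fun p => ~ P p) <-> ~ most P.

Lemma most_mono (P Q : I -> Prop) : (forall p, P p -> Q p) -> most P -> most Q.
Proof. by move=> PQ; apply: most_imp; exact: most_all. Qed.

Lemma most_False : ~ most (fun=> False).
Proof. exact: (proj1 (most_not (fun=> False)) (most_all (fun _ F => F))). Qed.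

Lemma most_and (P Q : I -> Prop) : most P -> most Q -> most (fun p => P p /\ Q p).
Proof. by move=> mP; apply: most_imp; apply: most_mono mP => p; split. Qed.

Lemma most_choice (P : I -> nat -> Prop) :
  most (fun p => exists x, P p x) -> exists f, most (fun p => P p (f p)).
Proof.
move=> H.
have [p|f fP] := @choice I nat (fun p x => (exists y, P p y) -> P p x).
  by have [[x Px]|nP] := EM (exists y, P p y); [exists x | exists 0].
by exists f; apply: most_mono H => p; exact: fP.
Qed.

Variable s : nat -> I -> nat.
Hypothesis s_ge2 : most (fun p => 2 <= s 0 p).
Hypothesis s_sqr : forall i, most (fun p => s i p * s i p <= s i.+1 p).
Hypothesis s_gap : forall C m, below m.+1 C -> forall i j, most (fun p =>
  forall rho, (forall x, x < m -> rho x < s i p) ->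
  (exists2 y, y < s j p & holds (scons y rho) C) ->
  exists2 y, y < s i.+1 p & holds (scons y rho) C).

(** The cut, an initial segment of the ultrapower; the inequalities [s_sqr] make it closed under sum
    and product. *)
Definition small (x : I -> nat) : Prop := exists i, most (fun p => x p < s i p).

Lemma s_le i j : i <= j -> most (fun p => 2 <= s i p /\ s i p <= s j p).
Proof.
have s2 k : most (fun p => 2 <= s k p).
  elim: k => // k IH; apply: most_mono (most_and IH (s_sqr k)) => p []; nia.
elim: j => [|j IH]; first by rewrite leqn0 => /eqP ->; apply: most_mono (s2 0).
rewrite leq_eqVlt => /orP[/eqP ->|]; first by apply: most_mono (s2 j.+1).
rewrite ltnS => /IH ij; apply: most_mono (most_and ij (s_sqr j)) => p []; nia.
Qed.

Lemma small_le x y : most (fun p => x p <= y p) -> small y -> small x.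
Proof.
move=> xy [i yi]; exists i; apply: most_mono (most_and xy yi) => p [].
exact: leq_ltn_trans.
Qed.

Lemma small_common x y : small x -> small y ->
  exists i, most (fun p => [/\ 2 <= s i p, x p < s i p & y p < s i p]).
Proof.
move=> [i xi] [j yj]; exists (maxn i j).
have := most_and (most_and xi yj) (most_and (s_le (leq_maxl i j)) (s_le (leq_maxr i j))).
apply: most_mono => p [[xp yp] [[i2 ik] [j2 jk]]].
by split; [exact: leq_trans ik | exact: leq_trans ik | exact: leq_trans jk].
Qed.

Lemma small_add x y : small x -> small y -> small (fun p => x p + y p).
Proof.
move=> sx sy; have [i xy] := small_common sx sy; exists i.+1.
by apply: most_mono (most_and xy (s_sqr i)) => p [[]]; nia.
Qed.

Lemma small_mul x y : small x -> small y -> small (fun p => x p * y p).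
Proof.
move=> sx sy; have [i xy] := small_common sx sy; exists i.+1.
by apply: most_mono (most_and xy (s_sqr i)) => p [[]]; nia.
Qed.

Lemma small_const01 c : c <= 1 -> small (fun=> c).
Proof. by move=> c1; exists 0; apply: most_mono s_ge2 => p; exact: leq_ltn_trans. Qed.

Definition at_ (p : I) (rho : nat -> I -> nat) : nat -> nat := fun i => rho i p.

Definition small_env (rho : nat -> I -> nat) : Prop := forall i, small (rho i).

Lemma small_scons x rho : small x -> small_env rho -> small_env (scons x rho).
Proof. by move=> sx sr [|i] //=. Qed.

Lemma at_scons p x rho : at_ p (scons x rho) = scons (x p) (at_ p rho).
Proof. by apply: funext => -[]. Qed.

Lemma small_teval rho t : small_env rho -> small (fun p => teval (at_ p rho) t).
Proof.
move=> sr; elim: t => [i||| a IHa b IHb|a IHa b IHb] /=.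
- exact: sr.
- exact: small_const01.
- exact: small_const01.
- exact: small_add.
- exact: small_mul.
Qed.

(** No quotient is formed: elements are small functions, and equality is agreement at most indices.
    Invariance under this agreement, [models_same], then justifies the substitution rule. *)
Fixpoint models (rho : nat -> I -> nat) (A : form) : Prop :=
  match A with
  | Eq a b => most (fun p => teval (at_ p rho) a = teval (at_ p rho) b)
  | Lt a b => most (fun p => teval (at_ p rho) a < teval (at_ p rho) b)
  | Bot => False
  | Imp A B => models rho A -> models rho B
  | All A => forall x, small x -> models (scons x rho) A
  end.

Definition same_env (rho rho' : nat -> I -> nat) : Prop :=
  forall i, most (fun p => rho i p = rho' i p).

Lemma same_env_teval rho rho' t : same_env rho rho' ->
  most (fun p => teval (at_ p rho) t = teval (at_ p rho') t).
Proof.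
move=> rr; elim: t => [i||| a IHa b IHb|a IHa b IHb] /=; try exact: most_all.
- exact: rr.
- by apply: most_mono (most_and IHa IHb) => p [-> ->].
- by apply: most_mono (most_and IHa IHb) => p [-> ->].
Qed.

Lemma same_env_sym rho rho' : same_env rho rho' -> same_env rho' rho.
Proof. by move=> rr i; apply: most_mono (rr i) => p ->. Qed.

Lemma models_same rho rho' A : same_env rho rho' -> models rho A -> models rho' A.
Proof.
elim: A rho rho' => /= [a b|a b||A IHA B IHB|A IHA] rho rho' rr //.
- move=> ab; have := most_and (same_env_teval a rr) (same_env_teval b rr).
  by move=> /(most_and ab); apply: most_mono => p [ab' [<- <-]].
- move=> ab; have := most_and (same_env_teval a rr) (same_env_teval b rr).
  by move=> /(most_and ab); apply: most_mono => p [ab' [<- <-]].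
- by move=> AB /(IHA _ _ (same_env_sym rr))/AB; exact: IHB.
move=> H x sx; apply: IHA (H x sx) => -[|i] /=; [exact: most_all | exact: rr].
Qed.

Lemma models_subst rho sg A :
  models rho (subst sg A) <-> models (fun i p => teval (at_ p rho) (sg i)) A.
Proof.
elim: A rho sg => /= [a b|a b||A IHA B IHB|A IHA] rho sg //.
- have E t p := teval_tsubst (at_ p rho) sg t.
  by split; apply: most_mono => p; rewrite !E.
- have E t p := teval_tsubst (at_ p rho) sg t.
  by split; apply: most_mono => p; rewrite !E.
- by rewrite IHA IHB.
have E x : (fun i p => teval (at_ p (scons x rho)) (up sg i)) =
    scons x (fun i p => teval (at_ p rho) (sg i)).
  apply: funext => -[|i] //=; apply: funext => p.
  by rewrite /up /= /tshift teval_tsubst.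
by split=> H x /H; rewrite IHA E.
Qed.

Lemma models_shift rho x A : models (scons x rho) (shift A) <-> models rho A.
Proof. by rewrite /shift models_subst. Qed.

Lemma models_inst rho t A :
  models rho (inst t A) <-> models (scons (fun p => teval (at_ p rho) t) rho) A.
Proof.
rewrite /inst models_subst.
suff -> : (fun i p => teval (at_ p rho) (scons t Var i)) =
  scons (fun p => teval (at_ p rho) t) rho by [].
by apply: funext => -[].
Qed.

(** Soundness for the cut. It is also applied without axioms, to pass from a Sigma1 formula to its
    logically equivalent prenex form. *)
Lemma deriv_models (T : form -> Prop) G A : deriv T G A ->
  (forall B, T B -> forall rho, small_env rho -> models rho B) ->
  forall rho, small_env rho -> (forall B, List.In B G -> models rho B) ->
  models rho A.
Proof.
move=> der T_holds; elim: der => {G A}.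
- by move=> G A TA rho sr _; exact: T_holds.
- by move=> G A AG rho sr GH; exact: GH.
- by move=> G A B _ IH rho sr GH mA; apply: IH => // C [<-|/GH].
- by move=> G A B _ IHAB _ IHA rho sr GH; apply: IHAB => //; exact: IHA.
- move=> G A _ IH rho sr GH; apply: contrapT => nA.
  by apply: (IH rho) => // C [<-|/GH].
- move=> G A _ IH rho sr GH x sx; apply: IH; first exact: small_scons.
  by move=> B /List.in_map_iff[C [<- /GH mC]]; apply/models_shift.
- move=> G A t _ IH rho sr GH; apply/models_inst.
  by apply: (IH rho) => //; exact: small_teval.
- by move=> G t rho _ _ /=; exact: most_all.
move=> G A t u _ IHtu _ IHA rho sr GH; apply/models_inst.
have := IHA rho sr GH; rewrite models_inst; apply: models_same => -[|i] /=.
  exact: (IHtu rho).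
exact: most_all.
Qed.

Lemma models_Iff rho A B : models rho (Iff A B) -> models rho A <-> models rho B.
Proof.
move=> /= H; split=> m; apply: contrapT => n; apply: H => AB BA; apply: n.
  exact: AB.
exact: BA.
Qed.

(** Los's theorem, one direction for each class since the model is only a cut of
    the ultraproduct. *)
Lemma persistent_models b A rho : persistent b A -> small_env rho ->
  if b then models rho A -> most (fun p => holds (at_ p rho) A)
  else most (fun p => holds (at_ p rho) A) -> models rho A.
Proof.
elim: A b rho => /= [a c|a c||A IHA B IHB|A IHA] b rho.
- by case: b => _ _ mH.
- by case: b => _ _ mH.
- by case: b => // _ _ /most_False.
- move=> /andP[/IHA{}IHA /IHB{}IHB] sr.
  have {}IHA := IHA rho sr; have {}IHB := IHB rho sr.
  case: b IHA IHB => /= IHA IHB.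
    move=> AB; have [mA|nA] := EM (most (fun p => holds (at_ p rho) A)).
      by apply: most_mono (IHB (AB (IHA mA))).
    by move/most_not: nA; apply: most_mono.
  by move=> mAB /IHA mA; apply: IHB; exact: most_imp mAB mA.
move=> /andP[pA gA] sr; case: b pA gA => /= pA gA; last first.
  move=> H x sx; apply: (IHA false) => //; first exact: small_scons.
  by apply: most_mono H => p; rewrite at_scons.
move=> H; apply: contrapT => /most_not nH.
have : most (fun p => exists x, ~ holds (scons x (at_ p rho)) A).
  by apply: most_mono nH => p /existsNP.
move=> /most_choice[x nx].
case: A gA nx pA H IHA {nH} => // P Q /bounds0P[t ft Pt] nx pA H IHA.
(* A counterexample to [Imp P Q] satisfies [P], hence is below the term [t], whose value does not
   depend on it; so it lies in the cut. *)
have sx : small x.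
  apply: (@small_le _ (fun p => teval (at_ p (scons (fun=> 0) rho)) t)).
    apply: most_mono nx => p nPQ.
    rewrite at_scons (@teval_fresh0 t _ (x p)) //; apply: ltnW.
    by apply: (Pt (scons (x p) (at_ p rho))); apply: contrapT => nP; apply: nPQ => /nP.
  by apply: small_teval; apply: small_scons => //; exact: small_const01.
have := IHA true _ pA (small_scons sx sr) (H x sx) => mx.
by apply: most_False; apply: most_mono (most_and mx nx) => p []; rewrite at_scons.
Qed.

Lemma bounded_models A rho : bounded A -> small_env rho ->
  models rho A <-> most (fun p => holds (at_ p rho) A).
Proof.
move=> bA sr; split.
  exact: (persistent_models (bounded_persistent true bA) sr).
exact: (persistent_models (bounded_persistent false bA) sr).
Qed.

Lemma PA0_models A : PA0 A -> forall rho, small_env rho -> models rho A.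
Proof.
have pi B : persistent false B -> (forall r, holds r B) ->
    forall rho, small_env rho -> models rho B.
  move=> pB hB rho sr; apply: (persistent_models pB sr).
  by apply: most_all => p; exact: hB.
case=> {A}; try (apply: pi => //= r; lia || by move=> *; rewrite ?addn0; lia).
(* The order axiom alone asserts an unbounded existence, so it is not transferred as a Pi formula;
   the witness [y - x] lies in the cut because it is at most [y]. *)
move=> rho sr /= x sx y sy; apply => [xy noz|noz].
  apply: (noz (fun p => y p - x p)).
    apply: small_le sy; apply: most_all => p; exact: leq_subr.
  apply=> [yx0|]; last first.
    by apply: most_mono xy; rewrite /at_ /= => p xy; rewrite subnK // ltnW.
  apply: most_False; apply: most_mono (most_and xy yx0) => p []; rewrite /at_ /=; lia.
apply: contrapT => /most_not nxy; apply: noz => z sz; apply=> z0 yzx; apply: z0.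
by apply: most_mono (most_and nxy yzx) => p; rewrite /at_ /=; lia.
Qed.

Lemma iter_All_models n A : (forall rho, small_env rho -> models rho A) ->
  forall rho, small_env rho -> models rho (iter n All A).
Proof.
move=> mA; elim: n => //= n IH rho sr x sx; apply: IH; exact: small_scons.
Qed.

Lemma ISigma_models A : ISigma 1 A -> forall rho, small_env rho -> models rho A.
Proof.
case=> {A}; first exact: PA0_models.
move=> n A [B [[C [-> bC]] AB]] _; apply: iter_All_models => rho sr.
have [m mC] := below_exists C.
have {}mC : below m.+1 C by exact: below_leq mC.
have AE r : small_env r -> models r A <->
    exists2 y, small y & most (fun p => holds (scons (y p) (at_ p r)) C).
  move=> sr'; rewrite (models_Iff (A := A) (B := Ex C)); last first.
    by apply: (deriv_models AB) => // ? [].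
  split=> [H|[y sy Cy] H]; last first.
    apply: (H y) => //; apply/bounded_models => //; first exact: small_scons.
    by apply: most_mono Cy => p; rewrite at_scons.
  apply: contrapT => ny; apply: H => y sy /bounded_models Cy; apply: ny.
  exists y => //; have := Cy bC (small_scons sy sr'); apply: most_mono => p.
  by rewrite at_scons.
pose Phi x := models (scons x rho) A.
have instE : models rho (inst Zero A) <-> Phi (fun=> 0) by exact: models_inst.
have succE x : models (scons x rho)
    (subst (scons (Add (Var 0) One) (fun i => Var i.+1)) A) <->
    Phi (fun p => x p + 1).
  rewrite models_subst /Phi.
  suff -> : (fun i p => teval (at_ p (scons x rho))
      (scons (Add (Var 0) One) (fun i => Var i.+1) i)) =
    scons (fun p => x p + 1) rho by [].
  by apply: funext => -[].
suff ind : Phi (fun=> 0) -> (forall x, small x -> Phi x -> Phi (fun p => x p + 1)) ->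
    forall x, small x -> Phi x.
  move=> /= H; apply: ind.
    by apply/instE; apply: contrapT => n0; apply: H => /n0.
  move=> x sx Px; apply/succE; apply: contrapT => nS; apply: H => _ H.
  by apply: nS; exact: H.
move=> P0 PS x sx; apply: contrapT => nPx.
have [i xi] : exists i, most (fun p => forall k, k < m -> scons x rho k p < s i p).
  elim: m {mC} => [|k [i IH]]; first by exists 0; exact: most_all.
  have [j kj] : small (scons x rho k) by exact: small_scons.
  exists (maxn i j).
  have := most_and (most_and IH kj) (most_and (s_le (leq_maxl i j)) (s_le (leq_maxr i j))).
  apply: most_mono => p [[xp yp] [[_ ik] [_ jk]]] l.
  rewrite ltnS leq_eqVlt => /orP[/eqP ->|lk]; first exact: leq_trans jk.
  exact: leq_trans (xp l lk) ik.
(* A witness in the cut is below some [s j], where [j] depends on [z]; the gap moves it below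
   [s i.+1], a bound common to all [z] up to [x]. Truth of [Phi] thus becomes a property of each
   coordinate. *)
pose psi p z := exists2 y, y < s i.+1 p & holds (scons y (scons z (at_ p rho))) C.
have PhiP z : small z -> most (fun p => z p <= x p) ->
    Phi z <-> most (fun p => psi p (z p)).
  move=> sz zx; rewrite /Phi AE; last exact: small_scons.
  split=> [[y [j yj] Cy]|H].
    have := most_and (most_and zx xi) (most_and (most_and yj Cy) (s_gap mC i j)).
    apply: most_mono => p [[zxp xip] [[yjp Cyp] gap]].
    apply: (gap (scons (z p) (at_ p rho))); last first.
      by exists (y p) => //; rewrite -(at_scons p z rho).
    case=> [|k] km; last exact: (xip k.+1 km).
    exact: leq_ltn_trans zxp (xip 0 km).
  have /most_choice[y yP] : most (fun p => exists y,
      y < s i.+1 p /\ holds (scons y (scons (z p) (at_ p rho))) C).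
    by apply: most_mono H => p [y ys Cy]; exists y.
  exists y; first by exists i.+1; apply: most_mono yP => p [].
  by apply: most_mono yP => p [_]; rewrite at_scons.
have psi0 : most (fun p => psi p 0).
  by apply/(PhiP (fun=> 0)) => //; [exact: small_const01 | exact: most_all].
have npsi : most (fun p => ~ psi p (x p)).
  by apply/most_not => psix; apply: nPx; apply/PhiP => //; exact: most_all.
(* Ordinary induction in each coordinate yields a place where [psi] fails to pass to the successor;
   these places form an element of the cut below [x]. *)
have /most_choice[z zP] : most (fun p => exists z,
    [/\ z < x p, psi p z & ~ psi p (z + 1)]).
  apply: most_mono (most_and psi0 npsi) => p [].
  elim: (x p) => // k IH p0 nk.
  have [pk|npk] := EM (psi p k); first by exists k; rewrite addn1.
  by have [z [zk pz nz]] := IH p0 npk; exists z; rewrite leqW.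
have sz : small z.
  by apply: small_le sx; apply: most_mono zP => p [/ltnW].
have Pz : Phi z.
  by apply/PhiP => //; apply: most_mono zP => p [] // /ltnW.
have := PS z sz Pz; rewrite PhiP.
- move=> H; apply: most_False.
  by apply: most_mono (most_and H zP) => p [pz [_ _ /(_ pz)]].
- by apply: small_add => //; exact: small_const01.
- by apply: most_mono zP => p [zx _ _]; rewrite addn1.
Qed.
End Model.

(** * The ultrafilter and the unprovability *)

Definition tail_filter (P : set (seq form * nat)) : Prop :=
  exists L0 k0, forall L k, (forall C, List.In C L0 -> List.In C L) -> k0 <= k ->
    P (L, k).

Lemma tail_filter_proper : ProperFilter tail_filter.
Proof.
split.
  by move=> [L0 [k0 /(_ L0 k0 (fun _ => id) (leqnn _))]].
split.
- by exists [::], 0.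
- move=> P Q [L0 [k0 HP]] [L1 [k1 HQ]]; exists (L0 ++ L1), (maxn k0 k1) => L k LL kk.
  split.
    apply: HP; last exact: leq_trans (leq_maxl _ _) kk.
    by move=> C CL; apply/LL/List.in_or_app; left.
  apply: HQ; last exact: leq_trans (leq_maxr _ _) kk.
  by move=> C CL; apply/LL/List.in_or_app; right.
by move=> P Q PQ [L0 [k0 HP]]; exists L0, k0 => L k LL kk; apply/PQ/HP.
Qed.

(** Since [most] extends the tail filter, most pairs contain any given formula in their list and
    exceed any given number. *)
Lemma ultra_tail : exists most : (seq form * nat -> Prop) -> Prop,
  [/\ forall P, tail_filter P -> most P,
      forall P Q : seq form * nat -> Prop, most (fun p => P p -> Q p) -> most P -> most Q
    & forall P : seq form * nat -> Prop, most (fun p => ~ P p) <-> ~ most P].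
Proof.
have [U [UU FU]] := ultraFilterLemma tail_filter_proper.
have PU : ProperFilter U by exact: ultra_proper.
have FiU : Filter U by exact: filter_filter.
exists U; split=> [P|P Q PQ UP|P]; first exact: FU.
  by apply: filterS (filterI PQ UP) => p [pq /pq].
split=> [nP UP|nP].
  have := filterI nP UP; have -> : ([set p | ~ P p] `&` P)%classic = classical_sets.set0.
    by apply/seteqP; split=> // p [].
  by move=> /(_ FiU); exact: filter_not_empty.
by have [] := in_ultra_setVsetC P UU.
Qed.

(** All universal quantifiers are bounded, so a length found in the cut is a true length in most
    coordinates. *)
Lemma stops_at_persistent : persistent true (G3StopsAt (bvar 0) (bvar 1) 2).
Proof. by vm_compute. Qed.

(** Here the existential quantifiers have to be bounded, including those of [Beta]; a true code of a
    word then remains one in the cut. *)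
Lemma word_persistent : persistent false (Word (bvar 0) 1).
Proof. by vm_compute. Qed.

Lemma not_provable : ~ provable (ISigma 1) G3_finite_form.
Proof.
have [most [most_tail most_imp most_not]] := ultra_tail.
have most_all P : (forall p, P p) -> most P.
  by move=> HP; apply: most_tail; exists [::], 0.
have [S HS] := choice (fun p : seq form * nat => long_gap_chain p.1 p.2).
have [Q HQ] := choice HS; have [c Hc] := choice HQ.
have {HS HQ}Hc p := Hc p.
pose s i p := S p i.
have tail C k P : (forall p, List.In C p.1 -> k <= p.2 -> P p) -> most P.
  move=> HP; apply: most_tail; exists [:: C], k => L k' LL kk.
  by apply: HP => //; apply: LL; left.
have mono := most_mono most_all most_imp.
have s_ge2 : most (fun p => 2 <= s 0 p).
  by apply: most_all => p; have [] := Hc p.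
have s_sqr i : most (fun p => s i p * s i p <= s i.+1 p).
  apply: (tail Bot i.+1) => p _ ip; have [_ _ _ _ /(_ i ip)[]] := Hc p.
  by [].
have s_up p i j : i <= j -> j <= p.2 -> 2 <= s i p /\ s i p <= s j p.
  have [_ _ s2 _ gaps] := Hc p.
  have step k : k <= p.2 -> 2 <= s k p.
    elim: k => // k IH kp; have [sq _] := gaps k kp.
    by move: sq (IH (ltnW kp)); rewrite /s; nia.
  elim: j => [|j IH]; first by rewrite leqn0 => /eqP ->; rewrite step.
  rewrite leq_eqVlt => /orP[/eqP -> jp|ij jp]; first by rewrite step.
  have [i2 sij] := IH ij (ltnW jp); split=> //; apply: leq_trans sij _.
  have [sq _] := gaps j jp; move: sq (step j (ltnW jp)); rewrite /s; nia.
have s_gap C m : below m.+1 C -> forall i j, most (fun p =>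
    forall rho, (forall x, x < m -> rho x < s i p) ->
    (exists2 y, y < s j p & holds (scons y rho) C) ->
    exists2 y, y < s i.+1 p & holds (scons y rho) C).
  (* The three thresholds ensure that the gap after [s i] exists, that [s j] is at most the end of
     the chain, and that enough parameters are allowed. *)
  move=> mC i j; apply: (tail C (maxn i.+1 (maxn j m))) => p pC.
  rewrite !geq_max => /and3P[ip jp mp] rho rho_s [y ys Cy].
  have [_ _ _ _ /(_ i ip)[_ gap]] := Hc p.
  (* The gap wants all [p.2] parameters below [s i]; those from [m] on do not occur in [C] and are
     reset to 0. *)
  pose rho' x := if x < m then rho x else 0.
  have E z : holds (scons z rho) C <-> holds (scons z rho') C.
    by apply: holds_below mC _ => -[|x] //=; rewrite ltnS /rho' => ->.
  have [|x _|| z zs /E Cz] := gap C pC _ rho'.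
  - by apply: below_leq mC.
  - rewrite /rho'; case: ifP => [/rho_s //|_].
    by have [s2 _] := s_up p i i (leqnn i) (ltnW ip); exact: ltnW.
  - exists y; last exact/E.
    by have [_] := s_up p j p.2 jp (leqnn _); exact: leq_trans.
  by exists z.
pose rho : nat -> seq form * nat -> nat := fun=> c.
have small_c : small most s c.
  by exists 0; apply: most_all => p; have [] := Hc p.
have small_rho : small_env most s rho by [].
move=> prov; have := deriv_models most_all most_imp s_ge2 s_sqr prov
  (ISigma_models most_all most_imp most_not s_ge2 s_sqr s_gap) small_rho.
move=> /(_ (fun B (H : List.In B [::]) => match H with end)) /(_ c small_c) model.
have word_c : models most s (scons c rho) (Word (bvar 0) 1).
  apply: (persistent_models most_all most_imp most_not s_ge2 s_sqr word_persistent).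
    exact: small_scons.
  apply: most_all => p; rewrite at_scons.
  have [cp _ _ _ _] := Hc p.
  apply/(@sat_word (bvar 0) 1 (scons (c p) (at_ p rho)) (c p)); first exact: denotes_bvar.
  by exists (word_of_blocks (slow_exps (Q p))).
apply: (model word_c) => n small_n model_n.
have [i n_i] := small_n.
have stops : most (fun p => holds (scons (n p) (scons (c p) (at_ p rho)))
    (G3StopsAt (bvar 0) (bvar 1) 2)).
  have := persistent_models most_all most_imp most_not s_ge2 s_sqr
    stops_at_persistent (small_scons small_n (small_scons small_c small_rho)) model_n.
  by apply: mono => p; rewrite !at_scons.
apply: (most_False most_all most_not).
have i_le : most (fun p => i <= p.2) by apply: (tail Bot i).
have both := most_and most_all most_imp (most_and most_all most_imp n_i stops) i_le.
(* At such an index [n p < s i p <= s p.2 p <= wait (Q p) 0 < n p], a contradiction. *)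
apply: mono both => p [[ni st] ip].
have [cp _ _ sk _] := Hc p.
have := @sat_g3_stops_at (bvar 0) (bvar 1) 2 (scons (n p) (scons (c p) (at_ p rho)))
  (c p) (n p) (word_of_blocks (slow_exps (Q p))).
rewrite /sat => H; move/H: st => st.
have {st} := slow_exps_long (st _ _ cp).
have [_ sip] := s_up p i p.2 ip (leqnn _).
move=> /(_ (denotes_scons _ (denotes_bvar _ _ _)) (denotes_bvar _ _ _)).
by rewrite ltnNge (leq_trans (ltnW ni)) // (leq_trans sip).
Qed.

Theorem theoremA :
  [/\ sentence G3_finite_form,
      forall (c : nat) (w : word) (n : nat), codes_word c w ->
        (forall rho : nat -> nat,
           holds (scons c (scons n rho)) G3_stops_at_form <->
           G3_stops_at (braid_of w) n),
      true_in_N G3_finite_form <-> (forall b : braid, G3_finite b)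
    & ~ provable (ISigma 1) G3_finite_form].
Proof.
split.
- by vm_compute.
- move=> c w n /codes_wordP cw rho.
  by apply: sat_g3_stops_at cw; exact: denotes_fvar.
- split=> [H|H rho].
    by apply/(g3_finite_sat (fun=> 0) 0); exact: H.
  by apply/(g3_finite_sat rho 0).
exact: not_provable.
Qed.
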